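(* Let $b\ge 2$ be an integer and let $F$ be a distribution function on $\mathbb{R}$. Let $\{S_v\}_{v\in V}$ be the branching random walk on the rooted $b$-ary tree with i.i.d. edge increments $X_e$ of common distribution $F$, and let $\Lambda(\lambda)=\log E e^{\lambda X_e}$. Assume that (i) $E e^{\lambda X_e}<\infty$ for some $\lambda<0$ and for some $\lambda>0$; (ii) there exist $\lambda_-<0$ and $\lambda_+>0$ in the interior of $\{\lambda\in\mathbb{R}:\Lambda(\lambda)<\infty\}$ such that $\lambda_\pm\Lambda'(\lambda_\pm)-\Lambda(\lambda_\pm)=\log b$. Let $m=\Lambda'(\lambda_-)$ and $$L_n=\min_{v\in\mathbb{D}_n}\ \max_{0\le k\le n}\bigl(S_{v^k}-mk\bigr).$$ Then $$\lim_{n\to\infty}\frac{L_n}{n^{1/3}}=l_0:=\left(\frac{3\pi^2\sigma_Q^2}{-2\lambda_-}\right)^{1/3}\qquad\text{almost surely},$$ where $\sigma_Q^2$ is the variance of a single increment under the exponentially tilted law $Q$ given by $\frac{dQ}{dP}(x)=e^{\lambda_- x-\Lambda(\lambda_-)}$, with $P$ the law on $\mathbb{R}$ having distribution function $F$.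
   Context: Branching random walk: let $\mathbb{T}=(V,E)$ be the infinite rooted tree with root $o$ in which every vertex has exactly $b$ children. For $v\in V$, $|v|$ denotes the graph distance from $o$ to $v$, $\mathbb{D}_n=\{v\in V:|v|=n\}$, and for $0\le k\le |v|$, $v^k$ denotes the ancestor of $v$ in $\mathbb{D}_k$ (so $v^0=o$ and $v^{|v|}=v$). To each edge $e\in E$ one attaches a real random variable $X_e$; the family $\{X_e\}_{e\in E}$ is i.i.d. with common distribution function $F$. For $v\in\mathbb{D}_n$, $S_v=\sum_{i=0}^{n-1}X_{v^iv^{i+1}}$, where $X_{v^iv^{i+1}}$ is the variable attached to the edge joining $v^i$ and $v^{i+1}$; in particular $S_o=0$. All $S_v$ and all $L_n$, $n\ge 1$, are defined on the same probability space. Under the stated assumptions, $m=\Lambda'(\lambda_-)$ is the almost sure limit of $\frac1n\min_{v\in\mathbb{D}_n}S_v$. The mean of an increment under $Q$ is $\Lambda'(\lambda_-)=m$, so $\sigma_Q^2=\int (x-m)^2\,e^{\lambda_-x-\Lambda(\lambda_-)}\,P(dx)$. *)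

(* Defs.v *)
From HB Require Import structures.
From mathcomp Require Import all_boot all_order all_algebra.
From mathcomp Require Import all_classical all_reals all_analysis.
From mathcomp Require Import measurable_realfun.

Set Implicit Arguments.
Unset Strict Implicit.
Unset Printing Implicit Defensive.

Import Order.TTheory GRing.Theory Num.Theory.
Import numFieldNormedType.Exports.

Local Open Scope classical_set_scope.
Local Open Scope ring_scope.

Definition mutually_independent (d : measure_display) (T : measurableType d)
    (R : realType) (P : probability T R) (I : eqType) (X : I -> {RV P >-> R}) :=
  forall (s : seq I) (B : I -> set R), uniq s -> (forall i, measurable (B i)) ->
    (P (\big[setI/setT]_(i <- s) (X i @^-1` B i)) =
     \prod_(i <- s) P (X i @^-1` B i))%E.

(* A vertex is the word of child indices read along the path from the root
   (the root is [::]), so that |v| = size v, the ancestor of v at depth k is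
   take k v, and the vertices at depth n are the n-tuples.  The pair (v, i) is
   the edge joining v to its child rcons v i. *)
Definition vertex (b : nat) := seq 'I_b.
Definition edge (b : nat) := (vertex b * 'I_b)%type.

Section branching_random_walk.
Context {R : realType} {b : nat}.

(* x is a realization of the edge variables. *)
Definition position (x : edge b -> R) (v : vertex b) : R :=
  \sum_(i < size v) x (take i v, tnth (in_tuple v) i).

(* The extrema are taken in \bar R, where +oo and -oo are neutral for min and
   max; both index sets are finite and nonempty when 0 < b. *)
Definition min_max_deviation (m : R) (x : edge b -> R) (n : nat) : R :=
  fine (\big[Order.min/+oo%E]_(v : n.-tuple 'I_b)
          \big[Order.max/-oo%E]_(k < n.+1)
             (position x (take k v) - m * k%:R)%:E).

End branching_random_walk.

Section exponential_tilting.
Context {R : realType} (F : cumulativeBounded (0 : R) (1 : R)).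
Local Open Scope ereal_scope.

Definition law : probability (measurableTypeR R) R :=
  lebesgue_stieltjes_measure F.

Definition mgf (l : R) : \bar R := 'M_law (idfun : R -> R) l.

Definition log_mgf (l : R) : \bar R := lne (mgf l).

(* When mgf l = +oo there is no exponential tilt; the untilted law is then
   returned so that tilted_law l is a probability measure for every l. *)
Definition tilted_law (l : R) (A : set (measurableTypeR R)) : \bar R :=
  if log_mgf l < +oo
  then \int[law]_(x in A) (expR (l * x - fine (log_mgf l)))%:E
  else law A.

Lemma mgfE l : mgf l = \int[law]_x (expR (l * x))%:E.
Proof.
rewrite /mgf /mmt_gen_fun unlock.
by apply: eq_integral => x _ /=; rewrite mulrC.
Qed.

Let measurable_tilt (l c : R) :
  measurable_fun setT
    (fun x : measurableTypeR R => (expR (l * x - c))%:E : \bar R).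
Proof.
apply/measurable_EFinP; apply: measurableT_comp => //.
by apply: measurable_funB => //; exact: measurable_funM.
Qed.

Lemma mgf_gt0 l : 0 < mgf l.
Proof.
have e0 (x : R) : 0 <= (expR (l * x))%:E by rewrite lee_fin expR_ge0.
rewrite mgfE lt_neqAle integral_ge0 ?andbT; last by move=> x _; exact: e0.
apply/eqP => /esym I0.
have mf : measurable_fun setT
    (fun x : measurableTypeR R => (expR (l * x))%:E : \bar R).
  by under eq_fun do rewrite -[X in expR X]subr0; exact: measurable_tilt.
have := ae_eq_integral_abs law measurableT mf.
under eq_integral do rewrite gee0_abs ?e0//.
move=> [/(_ I0) [N [mN N0 sN]] _].
have NT : N = setT.
  rewrite -subTset => x _; apply: sN => /(_ I) [] /eqP.
  by rewrite gt_eqF ?expR_gt0.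
have := probability_setT law; rewrite -NT N0 => /esym/eqP; by rewrite onee_eq0.
Qed.

Section instances.
Variable l : R.

Let tilted0 : tilted_law l set0 = 0.
Proof.
by rewrite /tilted_law; case: ifP => _; [exact: integral_set0|exact: measure0].
Qed.

Let tilted_ge0 A : 0 <= tilted_law l A.
Proof.
rewrite /tilted_law; case: ifP => // _.
by apply: integral_ge0 => x _; rewrite lee_fin expR_ge0.
Qed.

Let tilted_sigma_additive : semi_sigma_additive (tilted_law l).
Proof.
rewrite /tilted_law; case: (log_mgf l < +oo).
  2: exact: measure_semi_sigma_additive.
move=> B mB tB mUB; rewrite ge0_integral_bigcup//=.
- apply: is_cvg_ereal_nneg_natsum_cond => n _ _.
  by apply: integral_ge0 => x _; rewrite lee_fin expR_ge0.
- by apply: measurable_funTS; exact: measurable_tilt.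
Qed.

HB.instance Definition _ := isMeasure.Build _ _ _ (tilted_law l)
  tilted0 tilted_ge0 tilted_sigma_additive.

Let tilted_setT : tilted_law l [set: _] = 1.
Proof.
rewrite /tilted_law; case: ifP => [fin|_]; last exact: probability_setT.
have M0 := mgf_gt0 l.
have Mfin : mgf l \is a fin_num.
  rewrite fin_numE gt_eqF ?(lt_trans _ M0)//=; apply/eqP => My.
  by move: fin; rewrite /log_mgf My.
have m0 : (0 < fine (mgf l))%R by rewrite fine_gt0// M0 ltey_eq Mfin.
rewrite /log_mgf -(fineK Mfin) lne_EFin//=.
under eq_integral => x _ do
  rewrite expRB lnK ?posrE// EFinM.
rewrite ge0_integralZr//=.
- by rewrite -mgfE -(fineK Mfin) -EFinM divff// gt_eqF.
- by under eq_fun do rewrite -[X in expR X]subr0; exact: measurable_tilt.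
- by rewrite lee_fin invr_ge0; exact: ltW.
Qed.

HB.instance Definition _ := @Measure_isProbability.Build _ _ R
  (tilted_law l) tilted_setT.

End instances.

End exponential_tilting.

(* Main.v *)
Require Import Defs.
From HB Require Import structures.
From mathcomp Require Import all_boot all_order all_algebra.
From mathcomp Require Import all_classical all_reals all_analysis.
From mathcomp Require Import measurable_realfun.
From mathcomp Require Import ring lra.
Set Implicit Arguments.
Unset Strict Implicit.
Unset Printing Implicit Defensive.
Import Order.TTheory GRing.Theory Num.Theory.
Import numFieldNormedType.Exports.
Local Open Scope classical_set_scope.
Local Open Scope ring_scope.

(* Write theta = - lm and let q_n(z) be the probability that some path of length
   n has all its centered positions at most z, so that L_n <= z has probability
   q_n(z).  Splitting at the root gives
     q_{n+1}(z) = 1 - (1 - E q_n(z - xi))^b  for z >= 0,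
   and b E [exp(- theta xi) g(xi)] is the expectation of g under the tilted
   increment law, which is centered with variance sigma^2.  Everything then
   follows from comparing q_n with explicit functions
     exp(theta (z - w_n)) cos(k (z / w_n - 1/2)),
   where the barrier width w_n grows by T / (theta w_n^2) at each step, hence
   w_n^3 ~ 3 T n / theta.  Under the tilt a step multiplies the cosine by
   1 - k^2 sigma^2 / (2 w^2), up to O(w^-3), while the widening multiplies the
   exponential by 1 - T / w^2.  So this is a supersolution when k < pi and
   T < k^2 sigma^2 / 2, and (with a raised cosine and a small prefactor, which
   absorbs the quadratic term of the recursion) a subsolution when k > pi and
   T > k^2 sigma^2 / 2.  Letting k tend to pi gives the critical width
   l0 n^(1/3) with l0^3 = 3 pi^2 sigma^2 / (2 theta).  Above it the subsolution
   only yields q_n >= exp(- delta n^(1/3)); delta' n^(1/3) more generations of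
   supercritical branching turn this into 1 - q_n <= C exp(- r n^(1/6)).
   Borel-Cantelli along n = N^6 and the monotonicity of L_n conclude. *)

(** * Trigonometric estimates *)

(** A comparison function has to be compared with q_n at z - x for every jump x, whereas a Taylor
    expansion is useful only for jumps small against w. Each trial function is therefore bounded by
    its exponential times a polynomial in x whose quartic term, of order (x / w)^4, takes over once
    |x| is comparable with w; only tilted moments of orders 0, 1, 2, 4 then enter. The tilt has mean
    zero because m = Lambda'(lm), and mass one because the equation for lm makes b exp(lm (x - m))
    the density of Q. The boost needs two speeds. Steps bounded by a constant raise exp(- delta N^2)
    to 3/4 at a height cost proportional to delta N^2, but their failure bound is stuck at the tail
    beyond that constant. Then N generations with steps up to g N cost g N^2 and leave a failure of
    order exp(- r N), which is summable. With n = N^6 the scales n^(1/3) and n^(1/6) are N^2 and N,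
    and since (N + 1)^2 / N^2 tends to 1, monotonicity fills the gaps between sixth powers. *)

Section trigonometric_estimates.
Context {R : realType}.
Implicit Types a u x y : R.

Lemma sin_mvt x y : x <= y -> exists2 c, x <= c <= y & sin y - sin x = cos c * (y - x).
Proof.
move=> xy; have [c] := @MVT_segment R sin cos x y xy
  (fun z _ => is_derive_sin z) (continuous_subspaceT (@continuous_sin R)).
by rewrite in_itv/= => ? ?; exists c.
Qed.

Lemma cos_mvt x y : x <= y -> exists2 c, x <= c <= y & cos y - cos x = - sin c * (y - x).
Proof.
move=> xy; have [c] := @MVT_segment R cos (fun z => - sin z) x y xy
  (fun z _ => is_derive_cos z) (continuous_subspaceT (@continuous_cos R)).
by rewrite in_itv/= => ? ?; exists c.
Qed.

Lemma cos_dist x y : `|cos x - cos y| <= `|x - y|.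
Proof.
wlog yx : x y / y <= x => [h|].
  by have /orP[yx|xy] := le_total y x; [exact: h|rewrite distrC [leRHS]distrC h].
have [c _ ->] := cos_mvt yx.
by rewrite normrM normrN ler_piMl ?normr_ge0// sin_max.
Qed.

Lemma norm_sin_le u : `|sin u| <= `|u|.
Proof.
have := cos_dist (u - pi / 2) (- (pi / 2)).
by rewrite cosBpihalf cosN cos_pihalf subr0 opprK subrK.
Qed.

Lemma one_sub_cos_le u : 0 <= 1 - cos u <= u ^+ 2 / 2.
Proof.
have -> : cos u = 1 - 2 * sin (u / 2) ^+ 2.
  have {1}-> : u = (u / 2) *+ 2 by rewrite -mulr_natr divfK.
  by rewrite cos_mulr2n sin2cos2; ring.
rewrite -real_normK ?num_real//.
have := norm_sin_le (u / 2); have := normr_ge0 (sin (u/2)).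
rewrite normrM (@ger0_norm _ 2^-1) ?invr_ge0//.
rewrite -[u ^+ 2]real_normK ?num_real//.
by move=> h1 h2; apply/andP; split; nra.
Qed.

(** By the mean value theorem u - sin u = (1 - cos c) u for some c between 0 and u. Both powers
    serve in [cos_taylor]: the cubic one next to sin a, the quadratic one, at u / 2, next to cos
    a. *)
Lemma sub_sin_le u : `|u - sin u| <= `|u| ^+ 3 / 2 /\ `|u - sin u| <= `|u| ^+ 2.
Proof.
wlog u0 : u / 0 <= u => [h|].
  have /orP[u0|u0] := le_total 0 u; first exact: h.
  by have := h (- u); rewrite sinN -opprD !normrN oppr_ge0; apply.
have [c /andP[c0 cu]] := sin_mvt u0; rewrite sin0 !subr0 => ->.
have -> : u - cos c * u = (1 - cos c) * u by ring.
have /andP[h0 h1] := one_sub_cos_le c.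
have h2 : 1 - cos c <= c.
  have := cos_dist 0 c; rewrite cos0 sub0r normrN !ger0_norm//.
have h3 : 1 - cos c <= u ^+ 2 / 2.
  by apply: le_trans h1 _; rewrite ler_wpM2r ?invr_ge0// lerXn2r ?nnegrE.
rewrite !ger0_norm ?mulr_ge0//; split.
  by rewrite exprSr mulrAC ler_wpM2r.
by rewrite expr2 ler_wpM2r// (le_trans h2).
Qed.

Lemma cos_taylor a u :
  `|cos (a - u) - (cos a + u * sin a - u ^+ 2 / 2 * cos a)| <= `|u| ^+ 3.
Proof.
have [h1 _] := sub_sin_le u.
have [_ h2] := sub_sin_le (u / 2).
have h3 := norm_sin_le (u / 2).
(* Since 1 - cos u = 2 sin(u/2)^2, the remainder along cos a is a difference of two squares. *)
have -> : cos (a - u) - (cos a + u * sin a - u ^+ 2 / 2 * cos a) =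
  cos a * (2 * (u / 2 - sin (u / 2)) * (u / 2 + sin (u / 2))) - sin a * (u - sin u).
  rewrite cosB; have -> : cos u = 1 - 2 * sin (u / 2) ^+ 2.
    have {1}-> : u = (u / 2) *+ 2 by rewrite -mulr_natr divfK.
    by rewrite cos_mulr2n sin2cos2; ring.
  by field.
apply: le_trans (ler_normB _ _) _; rewrite !normrM.
have ca : `|cos a| <= 1 by exact: cos_max.
have sa : `|sin a| <= 1 by exact: sin_max.
have {}h3 : `|u / 2 + sin (u / 2)| <= `|u|.
  apply: le_trans (ler_normD _ _) _; apply: le_trans (lerD (lexx _) h3) _.
  by rewrite normrM (@ger0_norm _ 2^-1) ?invr_ge0//; lra.
move: h2; rewrite [`|u / 2|]normrM (@ger0_norm _ 2^-1) ?invr_ge0//.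
rewrite (@ger0_norm _ 2)// => h2.
suff aux (v c s p q r : R) : p <= v ^+ 3 / 2 -> r <= v -> c <= 1 -> s <= 1 ->
    q <= (v / 2) ^+ 2 -> 0 <= v -> 0 <= c -> 0 <= s -> 0 <= p -> 0 <= q ->
    0 <= r -> c * (2 * q * r) + s * p <= v ^+ 3.
  by apply: aux; rewrite ?normr_ge0.
move=> {}h1 {}h3 c1 s1 {}h2 v0 c0 s0 p0 q0 r0.
have hq : q * r <= v ^+ 3 / 4.
  have -> : v ^+ 3 / 4 = (v / 2) ^+ 2 * v by field.
  exact: ler_pM.
have : c * (2 * q * r) <= 2 * (q * r) by rewrite -!mulrA ler_piMl// !mulr_ge0.
have : s * p <= p by rewrite ler_piMl.
nra.
Qed.

(** The cubic error is put in even powers of [x] so that it can be integrated against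
    [tilted_moments]. *)
Lemma cos_taylor_scaled a k x : 0 <= k ->
  `|cos (a - k * x) - (cos a + k * sin a * x - k ^+ 2 / 2 * cos a * x ^+ 2)| <=
  k ^+ 3 * (x ^+ 2 + x ^+ 4).
Proof.
move=> k0; have -> : cos a + k * sin a * x - k ^+ 2 / 2 * cos a * x ^+ 2 =
  cos a + (k * x) * sin a - (k * x) ^+ 2 / 2 * cos a by ring.
apply: le_trans (cos_taylor _ _) _.
rewrite normrM (ger0_norm k0) exprMn ler_wpM2l ?exprn_ge0//.
have -> : x ^+ 4 = (x ^+ 2) ^+ 2 by ring.
rewrite -[x ^+ 2]real_normK ?num_real//.
have := normr_ge0 x; move: (`|x| : R) => v v0; nra.
Qed.

Lemma cos_le_anti x y : 0 <= x -> x <= y -> y <= pi -> cos y <= cos x.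
Proof.
move=> x0 xy ypi; rewrite le_eqVlt; move: xy; rewrite le_eqVlt => /predU1P[->|xy].
  by rewrite eqxx.
by rewrite ltr_cos ?xy ?orbT// in_itv/= ?x0 ?ypi ?(le_trans (ltW xy)) ?(le_trans x0 (ltW xy)).
Qed.

Lemma cos_norm_le_anti x y : `|x| <= y -> y <= pi -> cos y <= cos x.
Proof. by move=> xy ypi; rewrite -(cos_norm x) cos_le_anti. Qed.

End trigonometric_estimates.

(** * The survival recursion *)

Section survival_recursion.
Context {R : realType} (nu : probability R R) (b : nat).
Implicit Types (q : R -> R) (y z : R).

Definition conv q z : R := \int[nu]_x q (z - x).

(** The root itself counts as a point of the path, at position 0, so nothing survives below a
    negative level. *)
Definition branch_step q z : R := if 0 <= z then 1 - (1 - conv q z) ^+ b else 0.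

(* The probability that some path of length n from the root has all its
   positions at most z, when the increments have law nu. *)
Definition survival n : R -> R := iter n branch_step (fun z => if 0 <= z then 1 else 0).

(** Monotonicity supplies measurability and the bounds supply integrability, so no further
    regularity is carried through the recursion. *)
Definition survival_like q :=
  {homo q : x y / x <= y} /\ forall z, 0 <= q z <= 1.

Lemma survival_like_integrable q z : survival_like q ->
  nu.-integrable setT (EFin \o (fun x => q (z - x))).
Proof.
move=> [qnd q01]; apply: measurable_bounded_integrable => //.
- by rewrite (le_lt_trans (probability_le1 _ _))// ltry.
- apply: (@nonincreasing_measurable _ _ (fun x => q (z - x))) => //.
  by move=> x y xy; apply: qnd; rewrite lerB.
- exists 1; split; first exact: num_real.
  move=> M M1 x _ /=; have /andP[q0 q1] := q01 (z - x).
  by rewrite ger0_norm// (le_trans q1)// ltW.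
Qed.

Lemma conv_ge0 q z : survival_like q -> 0 <= conv q z.
Proof. by move=> [_ q01]; apply: Rintegral_ge0 => x _; case/andP: (q01 (z - x)). Qed.

Lemma integrable_cst_prob (c : R) : nu.-integrable setT (EFin \o cst c).
Proof. exact: finite_measure_integrable_cst. Qed.

Lemma Rintegral_cst_prob (c : R) : \int[nu]_x c = c.
Proof. by rewrite Rintegral_cst//= probability_setT mulr1. Qed.

Lemma conv_le1 q z : survival_like q -> conv q z <= 1.
Proof.
move=> qq; rewrite -[leRHS]Rintegral_cst_prob; apply: le_Rintegral => //.
- exact: survival_like_integrable.
- exact: integrable_cst_prob.
- by move=> x _; case: qq => _ /(_ (z - x)) /andP[].
Qed.

Lemma conv_nd q : survival_like q -> {homo conv q : x y / x <= y}.
Proof.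
move=> qq x y xy; apply: le_Rintegral => //; try exact: survival_like_integrable.
by move=> t _; case: qq => + _; apply; rewrite lerB.
Qed.

Lemma conv_le q1 q2 z : survival_like q1 -> survival_like q2 ->
  (forall y, q1 y <= q2 y) -> conv q1 z <= conv q2 z.
Proof.
move=> qq1 qq2 le12; apply: le_Rintegral => //; exact: survival_like_integrable.
Qed.

Lemma one_sub_exp_le (p p' : R) : 0 <= p -> p <= p' -> p' <= 1 ->
  1 - (1 - p) ^+ b <= 1 - (1 - p') ^+ b.
Proof.
move=> p0 pp' p'1; rewrite lerD2l lerN2 lerXn2r ?nnegrE ?subr_ge0//.
  by rewrite (le_trans pp').
by rewrite lerD2l lerN2.
Qed.

Lemma one_sub_exp_bounds (p : R) : 0 <= p <= 1 -> 0 <= 1 - (1 - p) ^+ b <= 1.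
Proof.
move=> /andP[p0 p1]; have h0 : 0 <= 1 - p by rewrite subr_ge0.
by rewrite subr_ge0 exprn_ile1 ?gerBl//= exprn_ge0.
Qed.

Lemma survival_like_branch_step q : survival_like q -> survival_like (branch_step q).
Proof.
move=> qq; split=> [x y xy|z]; rewrite /branch_step.
  case: ifPn => x0; case: ifPn => y0 //.
  - by apply: one_sub_exp_le; rewrite ?conv_ge0 ?conv_le1 ?conv_nd.
  - by move: y0; rewrite (le_trans x0).
  - have /one_sub_exp_bounds/andP[] // : 0 <= conv q y <= 1 by rewrite conv_ge0 ?conv_le1.
case: ifPn => z0; last by rewrite lexx ler01.
by apply: one_sub_exp_bounds; rewrite conv_ge0 ?conv_le1.
Qed.

Lemma survivalS n : survival n.+1 = branch_step (survival n).
Proof. by []. Qed.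

Lemma survival_like_survival n : survival_like (survival n).
Proof.
elim: n => [|n IH]; last exact: survival_like_branch_step.
split=> [x y xy|z] /=; last by case: ifP; rewrite ?ler01 ?lexx.
  case: ifPn => x0; case: ifPn => y0 //; rewrite ?ler01//.
  by move: y0; rewrite (le_trans x0).
Qed.

Lemma survival_ge0 n z : 0 <= survival n z.
Proof. by case: (survival_like_survival n) => _ /(_ z) /andP[]. Qed.

Lemma survival_le1 n z : survival n z <= 1.
Proof. by case: (survival_like_survival n) => _ /(_ z) /andP[]. Qed.

Lemma survival_nd n : {homo survival n : x y / x <= y}.
Proof. by case: (survival_like_survival n). Qed.

Lemma survival_lt0 n z : z < 0 -> survival n z = 0.
Proof. by move=> z0; case: n => [|n] /=; rewrite /branch_step leNgt z0. Qed.

Lemma survival_anti z : {homo survival ^~ z : m n / (m <= n)%N >-> n <= m}.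
Proof.
suff h n y : survival n.+1 y <= survival n y.
  apply: homo_leq => [x//|x y t xy yt|m]; [exact: le_trans yt xy|exact: h].
elim: n y => [|n IH] y.
  rewrite survivalS {1}/branch_step /=; case: ifPn => // y0.
  have /one_sub_exp_bounds/andP[] // : 0 <= conv (survival 0) y <= 1.
  by rewrite conv_ge0 ?conv_le1//; exact: survival_like_survival.
rewrite (survivalS n.+1) (survivalS n) {1 3}/branch_step; case: ifPn => // y0.
by apply: one_sub_exp_le; rewrite ?conv_ge0 ?conv_le1 ?conv_le//;
  try apply: survival_like_branch_step; exact: survival_like_survival.
Qed.

(** Union bound over the children, that is, Bernoulli's inequality. *)
Lemma survivalS_le n z : 0 <= z ->
  survival n.+1 z <= b%:R * conv (survival n) z.
Proof.
move=> z0; rewrite survivalS /branch_step z0.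
have := conv_ge0 z (survival_like_survival n); have := conv_le1 z (survival_like_survival n).
move: (conv _ _) => p p1 p0.
rewrite lerBlDr -lerBlDl.
elim: b => [|k IH]; first by rewrite mul0r subr0 expr0.
rewrite exprSr; have h : (1 - p) ^+ k <= 1 by rewrite exprn_ile1 ?subr_ge0 ?gerBl.
rewrite -natr1 mulrDl mul1r opprD addrA.
by apply: le_trans (lerB IH (lexx p)) _; nra.
Qed.

(** Inclusion-exclusion to second order, with the pair term bounded crudely by (b p)^2. As b p (1 -
    b p) is not monotone in p, the lower bound p is substituted for the convolution before
    expanding. *)
Lemma survivalS_ge n z p : 0 <= z -> 0 <= p -> p <= conv (survival n) z ->
  b%:R * p * (1 - b%:R * p) <= survival n.+1 z.
Proof.
move=> z0 p0 pq; rewrite survivalS /branch_step z0.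
have q1 := conv_le1 z (survival_like_survival n).
apply: le_trans (one_sub_exp_le p0 pq q1).
have {q1 pq} p1 : p <= 1 := le_trans pq q1.
suff : (1 - p) ^+ b <= 1 - b%:R * p + (b%:R * p) ^+ 2 by nra.
elim: b => [|k IH]; first by rewrite !mul0r expr0 subr0 expr0n addr0.
have h : (1 - p) ^+ k <= 1 by rewrite exprn_ile1 ?subr_ge0 ?gerBl.
rewrite exprSr -natr1; have k0 : 0 <= k%:R :> R by rewrite ler0n.
have h' : 0 <= 1 - p by rewrite subr_ge0.
apply: le_trans (ler_wpM2r h' IH) _.
have : 0 <= p * k%:R by rewrite mulr_ge0.
have : 0 <= p * (k%:R * p) ^+ 2 by rewrite mulr_ge0// sqr_ge0.
have : 0 <= p ^+ 2 by rewrite sqr_ge0.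
have : 0 <= k%:R * p ^+ 2 by rewrite mulr_ge0// sqr_ge0.
nra.
Qed.

(* The measure b exp(- theta x) nu(dx) has moments 1, 0, s2 and K4 of respective
   orders 0, 1, 2 and 4; the third moment is never needed because
   |x|^3 <= x^2 + x^4. *)
Definition tilted_moments (theta s2 K4 : R) := forall c0 c1 c2 c4,
  nu.-integrable setT (EFin \o (fun x => expR (- theta * x) *
    (c0 + c1 * x + c2 * x ^+ 2 + c4 * x ^+ 4))) /\
  b%:R * (\int[nu]_x (expR (- theta * x) *
    (c0 + c1 * x + c2 * x ^+ 2 + c4 * x ^+ 4))) = c0 + c2 * s2 + c4 * K4.

(** A pointwise polynomial minorant, after extraction of the exponential, turns the convolution into
    a combination of moments. The linear coefficient drops out because the tilt is centered. *)
Lemma conv_ge theta s2 K4 q z D c0 c1 c2 c4 :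
  tilted_moments theta s2 K4 -> survival_like q ->
  (forall x, D * (expR (- theta * x) *
    (c0 + c1 * x + c2 * x ^+ 2 + c4 * x ^+ 4)) <= q (z - x)) ->
  D * (c0 + c2 * s2 + c4 * K4) <= b%:R * conv q z.
Proof.
move=> tm qq h; have [I0 <-] := tm c0 c1 c2 c4.
rewrite mulrCA ler_wpM2l// -RintegralZl//; apply: le_Rintegral => //.
- exact: (integrableZl measurableT D I0).
- exact: survival_like_integrable.
Qed.

Lemma conv_le_tilt theta s2 K4 q z D c0 c1 c2 c4 :
  tilted_moments theta s2 K4 -> survival_like q ->
  (forall x, q (z - x) <= D * (expR (- theta * x) *
    (c0 + c1 * x + c2 * x ^+ 2 + c4 * x ^+ 4))) ->
  b%:R * conv q z <= D * (c0 + c2 * s2 + c4 * K4).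
Proof.
move=> tm qq h; have [I0 <-] := tm c0 c1 c2 c4.
rewrite [leRHS]mulrCA ler_wpM2l// -RintegralZl//; apply: le_Rintegral => //.
- exact: survival_like_integrable.
- exact: (integrableZl measurableT D I0).
Qed.

End survival_recursion.

(** * Subsolutions and supersolutions *)

Section one_step.
Context {R : realType}.
Implicit Types (k w z x a : R).

Definition phase k w z : R := k * (z / w - 2^-1).

Lemma phase_norm k w z e : 0 < k -> 0 < w -> - (e * w) <= z <= (1 + e) * w ->
  `|phase k w z| <= k * (2^-1 + e).
Proof.
move=> k0 w0 /andP[z0 zw]; rewrite /phase normrM gtr0_norm// ler_pM2l// ler_norml.
have : - e <= z / w by rewrite ler_pdivlMr// mulNr.
have : z / w <= 1 + e by rewrite ler_pdivrMr.
by move=> ? ?; apply/andP; split; lra.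
Qed.

Lemma phaseB k w z x : w != 0 -> phase k w (z - x) = phase k w z - k / w * x.
Proof. by move=> w0; rewrite /phase; field. Qed.

(** For the increment h = T / (theta w^2) the phase moves by O(w^-3), the order of the Taylor
    error. *)
Lemma phase_widen k w z h : 0 < k -> 0 < w -> 0 <= h -> 0 <= z <= w + h ->
  `|phase k (w + h) z - phase k w z| <= k * h / w.
Proof.
move=> k0 w0 h0 /andP[z0 zw]; have wh0 : 0 < w + h by rewrite ltr_pwDl.
have -> : phase k (w + h) z - phase k w z = - (k * h / w * (z / (w + h))).
  by rewrite /phase; field; rewrite !gt_eqF.
have p0 : 0 <= k * h / w by rewrite divr_ge0 ?mulr_ge0// ltW.
rewrite normrN ger0_norm; last by rewrite mulr_ge0// divr_ge0// ltW.
rewrite ler_piMr//.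
by rewrite ler_pdivrMr// mul1r.
Qed.

(* For k slightly above pi, this vanishes at z = 0 and z = w, is nonnegative in
   between, and is convex near these zeros.  A plain cosine cannot be a
   subsolution near the edges, where the O(w^-3) errors are not small compared
   with the cosine itself; raising it leaves a margin of order w^-2. *)
Definition raised_cos k w z : R := cos (phase k w z) - cos (k / 2).

Lemma raised_cos_le2 k w z : raised_cos k w z <= 2.
Proof. by rewrite /raised_cos; have := cos_le1 (phase k w z); have := cos_geN1 (k / 2); lra. Qed.

(** Outside the barrier the phase exceeds k / 2 in absolute value, and on this strip it is at most 5
    k / 6. Past pi the cosine grows again, but reflection at pi keeps it below cos (k / 2) as long
    as 2 pi - 5 k / 6 >= k / 2, which is exactly k <= 3 pi / 2. *)
Lemma raised_cos_le0 k w z : pi < k -> k * 2 <= 3 * pi -> 0 < w ->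
  - (3^-1 * w) <= z <= (1 + 3^-1) * w -> ~~ (0 <= z <= w) -> raised_cos k w z <= 0.
Proof.
move=> pik kpi w0 zb zn; have pi0 : 0 < pi :> R := pi_gt0 R.
have k0 : 0 < k := lt_trans pi0 pik.
have t1 : `|phase k w z| <= k * (2^-1 + 3^-1) by apply: phase_norm.
have t2 : k / 2 <= `|phase k w z|.
  move: zn; rewrite negb_and -!ltNge /phase normrM gtr0_norm// ler_pM2l// => /orP[z0|wz].
    have zw0 : z / w < 0 by rewrite pmulr_llt0 ?invr_gt0.
    by rewrite ler0_norm; lra.
  have h : 1 < z / w by rewrite ltr_pdivlMr// mul1r.
  rewrite ger0_norm; lra.
rewrite /raised_cos subr_le0 -(cos_norm (phase _ _ _)).
move: t1 t2; move: (`|_| : R) => t t1 t2.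
have [tpi|tpi] := leP t pi; first by apply: cos_le_anti => //; rewrite divr_ge0// ltW.
have -> : cos t = cos (pi *+ 2 - t).
  by rewrite -(cosN (_ - t)) opprB -[RHS]cosD2pi subrK.
by apply: cos_le_anti; rewrite -?(mulr_natl pi); lra.
Qed.

Lemma inv_sqr_large (c : R) (K : R) w : 0 < c -> 1 <= w -> K / c <= w ->
  K / w ^+ 3 <= c / w ^+ 2.
Proof.
move=> c0 w1 Kw; have w0 : 0 < w := lt_le_trans ltr01 w1.
have -> : K / w ^+ 3 = K / w / w ^+ 2 by field; rewrite gt_eqF.
rewrite ler_wpM2r ?invr_ge0 ?exprn_ge0 ?(ltW w0)//.
by rewrite ler_pdivrMr// mulrC -ler_pdivrMr.
Qed.

Lemma sqr_large w : 1 <= w -> w <= w ^+ 2.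
Proof. by move=> w1; rewrite expr2 ler_peMr// (le_trans ler01). Qed.

End one_step.

(** * Subsolutions: one generation with a raised cosine *)

Section sub_solution.
Context {R : realType} (nu : probability R R) (b : nat) (theta s2 K4 : R).
Hypothesis b0 : (0 < b)%N.
Hypothesis theta0 : 0 < theta.
Hypothesis s20 : 0 < s2.
Hypothesis K40 : 0 <= K4.
Hypothesis tm : tilted_moments nu b theta s2 K4.
Implicit Types (k w z x a T A : R).

(* B stands for the numeral 512, which is slow to compute with. *)
Lemma conv_raised_cos (B : R) q k w z A : B = 2 * 4 ^+ 4 -> pi < k -> k * 2 <= 3 * pi -> 1 <= w ->
  0 <= A -> survival_like q ->
  (forall y, 0 <= y <= w -> A * expR (theta * (y - w)) * raised_cos k w y <= q y) ->
  0 <= z <= (1 + 12^-1) * w ->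
  A * expR (theta * (z - w)) * (raised_cos k w z - k ^+ 2 * s2 / 2 / w ^+ 2 * cos (phase k w z)
    - (s2 * k ^+ 3 + K4 * (k ^+ 3 + B)) / w ^+ 3) <= b%:R * conv nu q z.
Proof.
move=> BE pik kpi w1 A0 qq hq /andP[z0 zw].
have B0 : 0 <= B by rewrite BE mulr_ge0// exprn_ge0.
have w0 : 0 < w := lt_le_trans ltr01 w1.
have pi0 : 0 < pi :> R := pi_gt0 R; have k0 : 0 < k := lt_trans pi0 pik.
have kw0 : 0 <= k / w by rewrite divr_ge0// ltW.
(* Taylor polynomial of the raised cosine, lowered by the cubic error in its form x^2 + x^4 and by
   the quartic [B * (x / w) ^+ 4]. *)
pose c0 : R := raised_cos k w z.
pose c1 : R := k / w * sin (phase k w z).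
pose c2 : R := - ((k / w) ^+ 2 / 2 * cos (phase k w z)) - (k / w) ^+ 3.
pose c4 : R := - ((k / w) ^+ 3 + B / w ^+ 4).
have h x : A * expR (theta * (z - w)) * (expR (- theta * x) *
    (c0 + c1 * x + c2 * x ^+ 2 + c4 * x ^+ 4)) <= q (z - x).
  have q0 y : 0 <= q y by case: qq => _ /(_ y) /andP[].
  have -> : A * expR (theta * (z - w)) * (expR (- theta * x) *
      (c0 + c1 * x + c2 * x ^+ 2 + c4 * x ^+ 4)) =
      A * expR (theta * (z - x - w)) * (c0 + c1 * x + c2 * x ^+ 2 + c4 * x ^+ 4).
    have -> : expR (theta * (z - x - w)) = expR (theta * (z - w)) * expR (- theta * x).
      by rewrite -expRD; congr expR; ring.
    by rewrite !mulrA.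
  have D0 : 0 <= A * expR (theta * (z - x - w)) by rewrite mulr_ge0// expR_ge0.
  have poly_le : c0 + c1 * x + c2 * x ^+ 2 + c4 * x ^+ 4 <=
      raised_cos k w (z - x) - B * (x / w) ^+ 4.
    rewrite {1}/raised_cos (phaseB _ _ _ (lt0r_neq0 w0)).
    have := cos_taylor_scaled (phase k w z) x kw0.
    rewrite ler_norml => /andP[h1 _].
    rewrite /c0 /c1 /c2 /c4 /raised_cos expr_div_n; lra.
  (* From z <= (1 + 1/12) w, a jump of at most w / 4 lands in the strip of [raised_cos_le0], as 1/12
     + 1/4 = 1/3. For larger jumps the quartic is at least 2, which is what fixes [B], and makes the
     minorant nonpositive. *)
  have [xw|xw] := leP `|x| (4^-1 * w).
    move: xw; rewrite ler_norml => /andP[xw1 xw2].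
    have x4 : 0 <= B * (x / w) ^+ 4 by rewrite mulr_ge0// exprn_even_ge0.
    have [zxw|zxw] := boolP (0 <= z - x <= w).
      apply: le_trans (hq _ zxw); rewrite ler_wpM2l//.
      by apply: (le_trans poly_le); rewrite gerBl.
    apply: le_trans (q0 _); rewrite mulr_ge0_le0//.
    apply: (le_trans poly_le); rewrite subr_le0; apply: le_trans x4.
    by apply: raised_cos_le0 => //; apply/andP; split; lra.
  apply: le_trans (q0 _); rewrite mulr_ge0_le0//.
  apply: (le_trans poly_le); rewrite subr_le0; apply: le_trans (raised_cos_le2 _ _ _) _.
  have hx : 4^-1 <= `|x / w|.
    by rewrite normrM normfV (gtr0_norm w0) ler_pdivlMr// ltW.
  have -> : (x / w) ^+ 4 = `|x / w| ^+ 4.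
    by rewrite -normrX ger0_norm// exprn_even_ge0.
  have -> : 2 = B * (4^-1) ^+ 4 :> R by rewrite BE exprVn mulfK// expf_neq0.
  by rewrite ler_wpM2l// lerXn2r// nnegrE.
have := conv_ge tm qq h; apply: le_trans.
rewrite ler_wpM2l ?mulr_ge0 ?expR_ge0//.
have w34 : K4 * B / w ^+ 4 <= K4 * B / w ^+ 3.
  rewrite ler_wpM2l ?mulr_ge0// lef_pV2 ?posrE ?exprn_gt0//.
  by rewrite ler_weXn2l.
rewrite /c0 /c2 /c4 !expr_div_n.
have -> : (s2 * k ^+ 3 + K4 * (k ^+ 3 + B)) / w ^+ 3 =
  s2 * (k ^+ 3 / w ^+ 3) + K4 * (k ^+ 3 / w ^+ 3) + K4 * B / w ^+ 3.
  by field; rewrite gt_eqF.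
have -> : k ^+ 2 * s2 / 2 / w ^+ 2 = k ^+ 2 / w ^+ 2 * s2 / 2.
  by field; rewrite gt_eqF.
lra.
Qed.

Definition sub_bound A k w n := forall z, 0 <= z <= w ->
  A * expR (theta * (z - w)) * raised_cos k w z <= survival nu b n z.

(** Budget of one generation, with v = w^-2: the widening gains T, the cosine loses rho, and the
    quadratic term of the recursion may spend half of the surplus T - rho. The condition on v pays
    for the cross terms. *)
Lemma rate_product (rho T v : R) : 0 <= rho -> rho < T -> 0 <= v ->
  2 * T ^+ 2 * v <= T - rho ->
  1 <= (1 + T * v) * (1 - (T - rho) / 2 * v) * (1 - rho * v).
Proof.
move=> r0 rT v0 hv.
have h : 1 <= (1 + T * v) * (1 - (T + rho) / 2 * v).
  have : T * (T + rho) / 2 * v <= T ^+ 2 * v by rewrite ler_wpM2r//; nra.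
  move=> h1; have : 0 <= v * ((T - rho) / 2 - T * (T + rho) / 2 * v).
    by rewrite mulr_ge0//; lra.
  lra.
apply: (le_trans h); rewrite -[leRHS]mulrA ler_wpM2l//; first by rewrite addr_ge0// mulr_ge0//; lra.
have : 0 <= (T - rho) / 2 * rho * v ^+ 2 by rewrite mulr_ge0 ?sqr_ge0//; nra.
lra.
Qed.

Lemma sub_step k T : pi < k -> k * 2 <= 3 * pi -> k ^+ 2 * s2 / 2 < T ->
  exists W0, 1 <= W0 /\ forall w A n, W0 <= w -> 0 <= A ->
    A <= (T - k ^+ 2 * s2 / 2) / 8 / w ^+ 2 ->
    sub_bound A k w n -> sub_bound A k (w + T / theta / w ^+ 2) n.+1.
Proof.
move=> pik kpi; set rho := k ^+ 2 * s2 / 2 => rT.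
have pi0 : 0 < pi :> R := pi_gt0 R; have k0 : 0 < k := lt_trans pi0 pik.
have rho0 : 0 < rho by rewrite /rho divr_gt0// mulr_gt0// exprn_gt0.
have T0 : 0 < T := lt_trans rho0 rT.
have [B BE] : exists B : R, B = 2 * 4 ^+ 4 by exists (2 * 4 ^+ 4).
have B0 : 0 <= B by rewrite BE mulr_ge0// exprn_ge0.
set K := s2 * k ^+ 3 + K4 * (k ^+ 3 + B).
have K0 : 0 <= K by rewrite addr_ge0// mulr_ge0 ?addr_ge0 ?exprn_ge0 ?(ltW s20) ?(ltW k0).
set K2 := k * T / theta.
have K20 : 0 <= K2 by rewrite divr_ge0 ?mulr_ge0// ltW.
set bt := - cos (k / 2).
have bt0 : 0 < bt.
  rewrite oppr_gt0 -cos_pihalf ltr_cos ?in_itv/=; last 2 first.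
  - by apply/andP; split; lra.
  - by apply/andP; split; lra.
  by rewrite ltr_pM2r.
(* Thresholds for w: [a1] keeps the widening below w / 12, [a2] gives T / w^2 <= 1/2, [a3] absorbs
   the O(w^-3) errors into the margin rho bt / w^2, and [a4] meets the condition of
   [rate_product]. *)
pose a1 := 12 * T / theta; pose a2 := 2 * T; pose a3 := (K + K2) / (rho * bt).
pose a4 := 2 * T ^+ 2 / (T - rho).
have a10 : 0 <= a1 by rewrite divr_ge0 ?mulr_ge0// ltW.
have a20 : 0 <= a2 by rewrite mulr_ge0// ltW.
have a30 : 0 <= a3.
  by apply: divr_ge0; [exact: addr_ge0|apply: mulr_ge0; exact: ltW].
have a40 : 0 <= a4.
  by apply: divr_ge0; [rewrite mulr_ge0 ?sqr_ge0|rewrite subr_ge0 ltW].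
exists (1 + a1 + a2 + a3 + a4); split; first lra.
move=> w A n wW A0 Aw IH.
have w1 : 1 <= w by lra.
have [wa1 wa2 wa3 wa4] : [/\ a1 <= w, a2 <= w, a3 <= w & a4 <= w] by split; lra.
have w0 : 0 < w := lt_le_trans ltr01 w1.
have w20 : 0 < w ^+ 2 by rewrite exprn_gt0.
have ww2 := sqr_large w1.
pose v := (w ^+ 2)^-1; have v0 : 0 < v by rewrite invr_gt0.
have v1 : v <= 1 by rewrite invf_le1// (le_trans w1).
have vw : w * v <= 1 by rewrite /v ler_pdivrMr ?mul1r.
set h := T / theta / w ^+ 2.
have h0 : 0 <= h by rewrite divr_ge0 ?sqr_ge0// divr_ge0// ltW.
have hw : h <= 12^-1 * w.
  have : h <= T / theta by rewrite ler_piMr// divr_ge0// ltW.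
  by move/le_trans; apply; move: wa1; rewrite /a1 -mulrA; lra.
have Tv : T * v <= 2^-1.
  have : 2 * T * v <= w * v by rewrite ler_wpM2r// ltW.
  lra.
have thh : theta * h = T * v by rewrite /h /v; field; rewrite !gt_eqF.
have hexp : expR (theta * h) <= 2.
  rewrite thh; have h2 : 2^-1 <= expR (- (T * v)).
    by apply: le_trans (expR_ge1Dx _); lra.
  by rewrite -[leLHS]invrK -expRN -[2]invrK lef_pV2 ?posrE ?expR_gt0.
move=> z /andP[z0 zw].
set psi := raised_cos k (w + h) z.
have [psi0|psi0] := leP psi 0.
  by apply: le_trans (survival_ge0 _ _ _ _); rewrite mulr_ge0_le0// mulr_ge0// expR_ge0.
have ok := survival_like_survival nu b n.
have zz : 0 <= z <= (1 + 12^-1) * w by rewrite z0/=; lra.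
have := conv_raised_cos BE pik kpi w1 A0 ok IH zz.
rewrite -/rho -/K; set c := cos (phase k w z).
have -> : rho / w ^+ 2 * c = rho * v * c by [].
have -> : raised_cos k w z = c + bt by [].
set LB := c + bt - _ - _ => hconv.
have psic : psi <= c + bt + K2 / w ^+ 3.
  have : cos (phase k (w + h) z) - c <= K2 / w ^+ 3.
    apply: (le_trans (ler_norm _)); apply: (le_trans (cos_dist _ _)).
    apply: (le_trans (phase_widen k0 w0 h0 _)); first by rewrite z0.
    by rewrite le_eqVlt; apply/orP; left; apply/eqP; rewrite /K2 /h; field; rewrite !gt_eqF.
  by rewrite /psi /raised_cos /bt; lra.
have Kw : (K + K2) / w ^+ 3 <= rho * bt * v.
  by apply: inv_sqr_large => //; rewrite mulr_gt0.
have rv1 : rho * v <= 2^-1 by apply: le_trans Tv; rewrite ler_wpM2r// ltW.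
have rv0 : 0 <= rho * v by rewrite mulr_ge0 ?ltW.
have K2w : 0 <= K2 / w ^+ 3 by rewrite divr_ge0// exprn_ge0 ?ltW.
have KK2 : (K + K2) / w ^+ 3 = K / w ^+ 3 + K2 / w ^+ 3 by rewrite mulrDl.
have rv2 : 0 <= 1 - rho * v by rewrite subr_ge0 (le_trans rv1)// invf_le1// ler1n.
(* The step damps the cosine but not the constant [bt]. Comparing with the damped [psi] thus leaves
   a surplus rho bt v, which pays for the Taylor error and for the shift of the phase. *)
have LBpsi : (1 - rho * v) * psi <= LB.
  apply: (le_trans (ler_wpM2l rv2 psic)); rewrite /LB.
  have : rho * v * (K2 / w ^+ 3) >= 0 by rewrite mulr_ge0.
  move: Kw; rewrite KK2; lra.
have LB0 : 0 <= LB by apply: le_trans LBpsi; rewrite mulr_ge0// ltW.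
have LB2 : LB <= 2.
  have : c <= 1 by exact: cos_le1.
  have : -1 <= c by exact: cos_geN1.
  have : bt <= 1 by rewrite /bt; rewrite lerNl; exact: cos_geN1.
  have : 0 <= K / w ^+ 3 by rewrite divr_ge0// exprn_ge0 ?ltW.
  rewrite /LB; nra.
set D := A * expR (theta * (z - w)).
have D0 : 0 <= D by rewrite mulr_ge0 ?expR_ge0.
have bR0 : 0 < b%:R :> R by rewrite ltr0n.
have D2 : D <= 2 * A.
  rewrite /D mulrC ler_wpM2r//; apply: le_trans hexp; rewrite ler_expR ler_pM2l//.
  by rewrite lerBlDl.
have := @survivalS_ge R nu b n z (b%:R^-1 * (D * LB)) z0.
rewrite mulVKf ?gt_eqF// => hs; apply: le_trans (hs _ _); last 2 first.
- by rewrite mulr_ge0 ?invr_ge0 ?mulr_ge0// ltW.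
- by rewrite ler_pdivrMl.
have -> : A * expR (theta * (z - (w + h))) = D * expR (- (T * v)).
  by rewrite /D -mulrA -expRD -thh; congr (A * expR _); ring.
rewrite -(mulrA D _ psi) -(mulrA D LB) ler_wpM2l//.
(* Origin of the 8 in the bound on [A]: a factor 2 for the exponential beyond w, a factor 2 for
   [LB], and half of the surplus. *)
have A4 : D * LB <= (T - rho) / 2 * v.
  have : D * LB <= (2 * A) * 2 by apply: ler_pM.
  by move: Aw; rewrite -/v; lra.
have E1 : expR (- (T * v)) * (1 + T * v) <= 1.
  apply: (@le_trans _ _ (expR (- (T * v)) * expR (T * v))).
    by rewrite ler_wpM2l ?expR_ge0//; exact: expR_ge1Dx.
  by rewrite -expRD addNr expR0.
have h4 : 0 <= 1 - (T - rho) / 2 * v by lra.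
apply: (@le_trans _ _ (LB * (1 - (T - rho) / 2 * v))); last first.
  by rewrite ler_wpM2l// lerD2l lerN2.
apply: (@le_trans _ _ ((1 - rho * v) * psi * (1 - (T - rho) / 2 * v))); last first.
  by rewrite ler_wpM2r.
have := @rate_product rho T v (ltW rho0) rT (ltW v0).
have -> : 2 * T ^+ 2 * v <= T - rho.
  rewrite /v ler_pdivrMr//; move: wa4; rewrite /a4 ler_pdivrMr ?subr_gt0// => wa4.
  by apply: (le_trans wa4); rewrite mulrC ler_wpM2l// subr_ge0 ltW.
move=> /(_ isT) hr.
have E0 := expR_ge0 (- (T * v)).
apply: (@le_trans _ _ (expR (- (T * v)) * psi *
    ((1 + T * v) * (1 - (T - rho) / 2 * v) * (1 - rho * v)))).
  by rewrite ler_peMr// mulr_ge0// ltW.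
have -> : expR (- (T * v)) * psi * ((1 + T * v) * (1 - (T - rho) / 2 * v) * (1 - rho * v)) =
  (expR (- (T * v)) * (1 + T * v)) * ((1 - rho * v) * psi * (1 - (T - rho) / 2 * v)) by ring.
by rewrite ler_piMl// mulr_ge0// mulr_ge0// ltW.
Qed.

End sub_solution.

(** * Supersolutions: one generation with a plain cosine *)

Section super_solution.
Context {R : realType} (nu : probability R R) (b : nat) (theta s2 K4 : R).
Hypothesis theta0 : 0 < theta.
Hypothesis s20 : 0 < s2.
Hypothesis K40 : 0 <= K4.
Hypothesis tm : tilted_moments nu b theta s2 K4.
Implicit Types (k w z x a T C : R).

(** Since k < pi, the cosine stays above a positive constant on a strip of relative width 2 eta
    around the barrier. There [C] times this constant dominates the trivial bound q <= 1 above the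
    barrier. *)
Lemma conv_cos q k w z eta C : 0 < k -> 0 < eta ->
  k * (2^-1 + 2 * eta) < pi / 2 -> 1 <= w ->
  survival_like q -> (forall y, y < 0 -> q y = 0) ->
  1 <= C * cos (k * (2^-1 + 2 * eta)) ->
  (forall y, 0 <= y <= w -> q y <= C * expR (theta * (y - w)) * cos (phase k w y)) ->
  0 <= z <= (1 + eta) * w ->
  b%:R * conv nu q z <= C * expR (theta * (z - w)) * (cos (phase k w z)
    - k ^+ 2 * s2 / 2 / w ^+ 2 * cos (phase k w z)
    + (s2 * k ^+ 3 + K4 * (k ^+ 3 + 2 / eta ^+ 4)) / w ^+ 3).
Proof.
move=> k0 eta0 keta w1 qq qneg C1 hq /andP[z0 zw].
have w0 : 0 < w := lt_le_trans ltr01 w1.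
have kw0 : 0 <= k / w by rewrite divr_ge0// ltW.
set cc := cos _ in C1.
have cc1 : cc <= 1 by exact: cos_le1.
have pi0 : 0 < pi :> R := pi_gt0 R.
have cc0 : 0 < cc.
  apply: cos_gt0_pihalf; rewrite keta andbT.
  have : 0 < k * (2^-1 + 2 * eta) by rewrite mulr_gt0//; lra.
  lra.
have C0 : 0 < C by rewrite -(pmulr_lgt0 _ cc0) (lt_le_trans ltr01).
have C1' : 1 <= C by apply: (le_trans C1); rewrite ler_piMr// ltW.
pose c0 : R := cos (phase k w z).
pose c1 : R := k / w * sin (phase k w z).
pose c2 : R := - ((k / w) ^+ 2 / 2 * cos (phase k w z)) + (k / w) ^+ 3.
pose c4 : R := (k / w) ^+ 3 + 2 / (eta * w) ^+ 4.
have h x : q (z - x) <= C * expR (theta * (z - w)) * (expR (- theta * x) *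
    (c0 + c1 * x + c2 * x ^+ 2 + c4 * x ^+ 4)).
  have q0 y : 0 <= q y by case: qq => _ /(_ y) /andP[].
  have q1 y : q y <= 1 by case: qq => _ /(_ y) /andP[].
  have -> : C * expR (theta * (z - w)) * (expR (- theta * x) *
      (c0 + c1 * x + c2 * x ^+ 2 + c4 * x ^+ 4)) =
      C * expR (theta * (z - x - w)) * (c0 + c1 * x + c2 * x ^+ 2 + c4 * x ^+ 4).
    have -> : expR (theta * (z - x - w)) = expR (theta * (z - w)) * expR (- theta * x).
      by rewrite -expRD; congr expR; ring.
    by rewrite !mulrA.
  have D0 : 0 <= C * expR (theta * (z - x - w)) by rewrite mulr_ge0 ?expR_ge0// ltW.
  have poly_ge : cos (phase k w (z - x)) + 2 * (x / (eta * w)) ^+ 4 <=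
      c0 + c1 * x + c2 * x ^+ 2 + c4 * x ^+ 4.
    rewrite {1}(phaseB _ _ _ (lt0r_neq0 w0)).
    have := cos_taylor_scaled (phase k w z) x kw0.
    rewrite ler_norml => /andP[_ h1].
    rewrite /c0 /c1 /c2 /c4 (expr_div_n x); lra.
  have x4 : 0 <= 2 * (x / (eta * w)) ^+ 4 by rewrite mulr_ge0// exprn_even_ge0.
  (* Nonnegativity suffices for landings below 0, where q vanishes; the bound by [cc] serves
     landings above w. For |x| > eta w the quartic term exceeds 2, hence the sum exceeds 1. *)
  suff [hpos hout] : (0 <= cos (phase k w (z - x)) + 2 * (x / (eta * w)) ^+ 4) /\
      cc <= cos (phase k w (z - x)) + 2 * (x / (eta * w)) ^+ 4.
    have [y0|y0] := ltP (z - x) 0.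
      by rewrite qneg// mulr_ge0// (le_trans hpos).
    have [yw|yw] := leP (z - x) w.
      apply: (le_trans (hq _ _)); first by rewrite y0.
      by rewrite ler_wpM2l// (le_trans _ poly_ge)// lerDl.
    apply: (le_trans (q1 _)); apply: (le_trans C1).
    apply: ler_pM; rewrite ?(ltW C0) ?(ltW cc0)//; last exact: le_trans poly_ge.
    rewrite ler_peMr ?(ltW C0)// -(expR0 R) ler_expR mulr_ge0 ?(ltW theta0)//; lra.
  have [xw|xw] := leP `|x| (eta * w).
    move: xw; rewrite ler_norml => /andP[xw1 xw2].
    have hcc : cc <= cos (phase k w (z - x)).
      apply: cos_norm_le_anti; last lra.
      by apply: phase_norm => //; apply/andP; split; lra.
    by split; lra.
  have hx : 1 <= `|x / (eta * w)|.
    have ew : 0 < eta * w by rewrite mulr_gt0.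
    by rewrite normrM normfV (gtr0_norm ew) ler_pdivlMr// mul1r ltW.
  have hx4 : 1 <= (x / (eta * w)) ^+ 4.
    by rewrite -[leRHS]ger0_norm ?exprn_even_ge0// normrX exprn_ege1.
  by have := cos_geN1 (phase k w (z - x)); split; lra.
have := conv_le_tilt tm qq h; move/le_trans; apply.
rewrite ler_wpM2l ?mulr_ge0 ?expR_ge0 ?(ltW C0)//.
have w34 : K4 * 2 / eta ^+ 4 / w ^+ 4 <= K4 * 2 / eta ^+ 4 / w ^+ 3.
  rewrite ler_wpM2l ?divr_ge0 ?mulr_ge0 ?exprn_ge0 ?(ltW eta0)//.
  by rewrite lef_pV2 ?posrE ?exprn_gt0// ler_weXn2l.
rewrite /c0 /c2 /c4 !expr_div_n exprMn.
have -> : (s2 * k ^+ 3 + K4 * (k ^+ 3 + 2 / eta ^+ 4)) / w ^+ 3 =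
  s2 * (k ^+ 3 / w ^+ 3) + K4 * (k ^+ 3 / w ^+ 3) + K4 * 2 / eta ^+ 4 / w ^+ 3.
  by field; rewrite !gt_eqF.
have -> : k ^+ 2 * s2 / 2 / w ^+ 2 = k ^+ 2 / w ^+ 2 * s2 / 2.
  by field; rewrite gt_eqF.
rewrite (invfM (eta ^+ 4)).
lra.
Qed.

Definition super_bound C k w n := forall z, 0 <= z <= w ->
  survival nu b n z <= C * expR (theta * (z - w)) * cos (phase k w z).

(** The threshold and [c1] precede [C] and [n], so that one constant [C] serves all generations. *)
Lemma super_step k T : 0 < k -> k < pi -> 0 < T -> T < k ^+ 2 * s2 / 2 ->
  exists W0 c1, [/\ 1 <= W0, 0 < c1 & forall w C n, W0 <= w -> 1 <= C * c1 ->
    super_bound C k w n -> super_bound C k (w + T / theta / w ^+ 2) n.+1].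
Proof.
move=> k0 kpi T0; set rho := k ^+ 2 * s2 / 2 => Trho.
have pi0 : 0 < pi :> R := pi_gt0 R.
(* This makes k (1/2 + 2 eta) the midpoint of k / 2 and pi / 2. *)
pose eta := (pi / k - 1) / 8.
have eta0 : 0 < eta by rewrite divr_gt0// subr_gt0 ltr_pdivlMr// mul1r.
have keta : k * (2^-1 + 2 * eta) < pi / 2.
  have -> : k * (2^-1 + 2 * eta) = k / 4 + pi / 4 by rewrite /eta; field; rewrite gt_eqF.
  lra.
set c1 := cos (k * (2^-1 + 2 * eta)).
have kk0 : 0 < k * (2^-1 + 2 * eta) by rewrite mulr_gt0//; lra.
have c10 : 0 < c1 by apply: cos_gt0_pihalf; rewrite keta andbT; lra.
set K := s2 * k ^+ 3 + K4 * (k ^+ 3 + 2 / eta ^+ 4).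
have K0 : 0 <= K.
  apply: addr_ge0; first by rewrite mulr_ge0 ?exprn_ge0 ?ltW.
  by rewrite mulr_ge0// addr_ge0 ?divr_ge0 ?exprn_ge0// ltW.
set K2 := k * T / theta.
have K20 : 0 <= K2 by apply: divr_ge0; [apply: mulr_ge0|]; exact: ltW.
(* [a1] keeps the widening below eta w. [a2] lets the surplus (rho - T) c1 / w^2, available since
   the cosine is at least [c1], absorb the O(w^-3) errors. *)
pose a1 := T / theta / eta; pose a2 := (K + K2) / ((rho - T) * c1).
have a10 : 0 <= a1.
  by apply: divr_ge0; [apply: divr_ge0|]; exact: ltW.
have rT : 0 < rho - T by rewrite subr_gt0.
have a20 : 0 <= a2 by apply: divr_ge0; [exact: addr_ge0|apply: mulr_ge0; exact: ltW].
exists (1 + a1 + a2 + T), c1; split => //; first lra.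
move=> w C n wW C1 IH.
have w1 : 1 <= w by lra.
have [wa1 wa2 wT] : [/\ a1 <= w, a2 <= w & T <= w] by split; lra.
have w0 : 0 < w := lt_le_trans ltr01 w1.
have w20 : 0 < w ^+ 2 by rewrite exprn_gt0.
have ww2 := sqr_large w1.
pose v := (w ^+ 2)^-1; have v0 : 0 < v by rewrite invr_gt0.
set h := T / theta / w ^+ 2.
have Tth0 : 0 <= T / theta by apply: divr_ge0; exact: ltW.
have h0 : 0 <= h by apply: divr_ge0 => //; exact: ltW.
have hw : h <= eta * w.
  have : h <= T / theta by rewrite ler_piMr// invf_le1// (le_trans w1).
  by move/le_trans; apply; move: wa1; rewrite /a1 ler_pdivrMr// (mulrC w).
have thh : theta * h = T * v by rewrite /h /v; field; rewrite !gt_eqF.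
move=> z /andP[z0 zw].
have C0 : 0 < C by rewrite -(pmulr_lgt0 _ c10) (lt_le_trans ltr01).
have ok := survival_like_survival nu b n.
have zz : 0 <= z <= (1 + eta) * w by rewrite z0/=; lra.
have := conv_cos k0 eta0 keta w1 ok (@survival_lt0 _ _ _ _) C1 IH zz.
rewrite -/rho -/K; set c := cos (phase k w z).
have -> : rho / w ^+ 2 * c = rho * v * c by [].
have := survivalS_le nu b n z0; move=> /le_trans hs /hs{hs}.
move=> /le_trans; apply.
set c' := cos (phase k (w + h) z).
have c'0 : 0 <= c'.
  apply: cos_ge0_pihalf; rewrite -ler_norml.
  have := @phase_norm R k (w + h) z 0 k0; rewrite mul0r oppr0 !addr0 mul1r z0 zw.
  move=> hp; apply: (le_trans (hp _ isT)); last by rewrite ler_pM2r// ltW.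
  by rewrite ltr_pwDl.
have cc' : c - c' <= K2 / w ^+ 3.
  apply: (le_trans (ler_norm _)); rewrite distrC; apply: (le_trans (cos_dist _ _)).
  apply: (le_trans (phase_widen k0 w0 h0 _)); first by rewrite z0.
  by rewrite le_eqVlt; apply/orP; left; apply/eqP; rewrite /K2 /h; field; rewrite !gt_eqF.
have c1c : c1 <= c.
  apply: cos_norm_le_anti; last lra.
  by apply: phase_norm => //; apply/andP; split; nra.
have Kw : (K + K2) / w ^+ 3 <= (rho - T) * c1 * v.
  by apply: inv_sqr_large => //; rewrite mulr_gt0.
have KK2 : (K + K2) / w ^+ 3 = K / w ^+ 3 + K2 / w ^+ 3 by rewrite mulrDl.
have Tv1 : T * v <= 1 by rewrite ler_pdivrMr// mul1r (le_trans wT).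
have Tv0 : 0 <= T * v by rewrite mulr_ge0 ?ltW.
have -> : C * expR (theta * (z - (w + h))) = C * expR (theta * (z - w)) * expR (- (T * v)).
  by rewrite -mulrA -expRD -thh; congr (C * expR _); ring.
rewrite -(mulrA _ _ c') ler_wpM2l ?mulr_ge0 ?expR_ge0 ?(ltW C0)//.
apply: (@le_trans _ _ ((1 - T * v) * c')); last by rewrite ler_wpM2r// expR_ge1Dx.
have K2w : 0 <= K2 / w ^+ 3 by rewrite divr_ge0// exprn_ge0 ?ltW.
have h1 : 0 <= 1 - T * v by lra.
have h2 : (1 - T * v) * (c - K2 / w ^+ 3) <= (1 - T * v) * c' by rewrite ler_wpM2l//; lra.
apply: (le_trans _ h2).
have h3 : (rho - T) * c1 * v <= (rho - T) * c * v.
  by rewrite ler_wpM2r ?(ltW v0)// ler_wpM2l// ltW.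
have h4 : 0 <= T * v * (K2 / w ^+ 3) by rewrite mulr_ge0.
move: h3 h4 Kw KK2; move: (K2 / w ^+ 3) (K / w ^+ 3) ((K + K2) / w ^+ 3) => p r s.
move=> h3 h4 Kw KK2; lra.
Qed.

End super_solution.

(** * Asymptotics of the survival probability *)

Section barrier_width.
Context {R : realType}.
Implicit Types (c W : R).

(* A discretization of w' = c / w^2, whose solutions satisfy (w^3)' = 3 c. *)
Definition width c W n : R := iter n (fun w => w + c / w ^+ 2) W.

Lemma widthS c W n : width c W n.+1 = width c W n + c / width c W n ^+ 2.
Proof. by []. Qed.

Lemma width_nd c W : 0 <= c -> {homo width c W : m n / (m <= n)%N >-> m <= n}.
Proof.
move=> c0; apply: homo_leq => [//|x y t xy yt|m]; first exact: le_trans xy yt.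
by rewrite widthS lerDl divr_ge0// sqr_ge0.
Qed.

Lemma width_ge c W n : 0 <= c -> W <= width c W n.
Proof. by move=> c0; exact: (@width_nd c W c0 0%N). Qed.

Lemma width_cube_ge c W n : 0 <= c -> 1 <= W -> 3 * c * n%:R <= width c W n ^+ 3.
Proof.
move=> c0 W1; elim: n => [|n IH].
  by rewrite mulr0 exprn_ge0// (le_trans ler01).
have w1 := le_trans W1 (width_ge W n c0).
rewrite widthS; move: (width c W n) w1 IH => w w1 IH.
have w0 : 0 < w := lt_le_trans ltr01 w1.
have -> : (w + c / w ^+ 2) ^+ 3 = w ^+ 3 + 3 * c + 3 * c ^+ 2 / w ^+ 3 + (c / w ^+ 2) ^+ 3.
  by field; rewrite gt_eqF.
have h1 : 0 <= 3 * c ^+ 2 / w ^+ 3.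
  by apply: divr_ge0; [rewrite mulr_ge0 ?sqr_ge0|rewrite exprn_ge0 ?(ltW w0)].
have h2 : 0 <= (c / w ^+ 2) ^+ 3 by rewrite exprn_ge0// divr_ge0// sqr_ge0.
by rewrite -(natr1 n); lra.
Qed.

(** A large starting width brings the slope of w^3 as close to 3 c as desired. *)
Lemma width_cube_le c W n : 0 <= c -> 1 <= W ->
  width c W n ^+ 3 <= W ^+ 3 + (3 * c + (3 * c ^+ 2 + c ^+ 3) / W) * n%:R.
Proof.
move=> c0 W1; elim: n => [|n IH]; first by rewrite mulr0 addr0.
have Ww := width_ge W n c0.
rewrite widthS; move: (width c W n) Ww IH => w Ww IH.
have W0 : 0 < W := lt_le_trans ltr01 W1.
have w1 := le_trans W1 Ww; have w0 : 0 < w := lt_le_trans ltr01 w1.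
have -> : (w + c / w ^+ 2) ^+ 3 = w ^+ 3 + 3 * c + 3 * c ^+ 2 / w ^+ 3 + c ^+ 3 / w ^+ 6.
  by field; rewrite gt_eqF.
have wpow m : W <= w ^+ m.+1.
  by apply: (le_trans Ww); rewrite -[leLHS]expr1 ler_weXn2l.
have h1 : 3 * c ^+ 2 / w ^+ 3 <= 3 * c ^+ 2 / W.
  by rewrite ler_wpM2l ?mulr_ge0 ?sqr_ge0// lef_pV2 ?posrE ?exprn_gt0.
have h2 : c ^+ 3 / w ^+ 6 <= c ^+ 3 / W.
  by rewrite ler_wpM2l ?exprn_ge0// lef_pV2 ?posrE ?exprn_gt0.
by rewrite -(natr1 n) mulrDr mulr1 (mulrDl (3 * c ^+ 2)); lra.
Qed.

Lemma cube_room_above (l L : R) : 0 < l -> l ^+ 3 < L -> exists2 l1, l < l1 & l1 ^+ 3 < L.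
Proof.
move=> l0 lL; have l30 : 0 < l ^+ 3 by rewrite exprn_gt0.
(* For e <= 1 one has (1 + e)^3 <= 1 + 7 e; the 8 makes the inequality strict. *)
pose e := Num.min 1 ((L - l ^+ 3) / (8 * l ^+ 3)).
have e0 : 0 < e by rewrite lt_min ltr01 divr_gt0 ?mulr_gt0// subr_gt0.
have e1 : e <= 1 by rewrite ge_min lexx.
have e2 : e * (8 * l ^+ 3) <= L - l ^+ 3.
  by rewrite -ler_pdivlMr ?mulr_gt0// ge_min lexx orbT.
exists (l * (1 + e)); first by rewrite ltr_pMr// ltrDl.
rewrite exprMn; have h : (1 + e) ^+ 3 <= 1 + 7 * e by nra.
apply: (le_lt_trans (ler_wpM2l (ltW l30) h)).
have : 0 < e * l ^+ 3 by rewrite mulr_gt0.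
lra.
Qed.

Lemma cube_room_below (l L : R) : 0 <= L -> 0 < l -> L < l ^+ 3 ->
  exists l1, [/\ 0 < l1, l1 < l & L < l1 ^+ 3].
Proof.
move=> L0 l0 lL; have l30 : 0 < l ^+ 3 by rewrite exprn_gt0.
pose e := (l ^+ 3 - L) / (4 * l ^+ 3).
have e0 : 0 < e by rewrite divr_gt0 ?mulr_gt0// subr_gt0.
have e2 : e * (4 * l ^+ 3) = l ^+ 3 - L.
  by rewrite /e divfK// mulf_neq0// gt_eqF.
have e1 : e <= 4^-1.
  by rewrite ler_pdivrMr ?mulr_gt0//; lra.
exists (l * (1 - e)); split.
- by rewrite mulr_gt0//; lra.
- by rewrite gtr_pMr//; lra.
rewrite exprMn; have h : 1 - 3 * e <= (1 - e) ^+ 3 by nra.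
apply: (lt_le_trans _ (ler_wpM2l (ltW l30) h)).
have : 0 < e * l ^+ 3 by rewrite mulr_gt0.
lra.
Qed.

Lemma ler_cube (x y : R) : 0 <= y -> x ^+ 3 <= y ^+ 3 -> x <= y.
Proof.
move=> y0; have [x0|x0] := leP 0 x; first by rewrite ler_pXn2r ?nnegrE.
by move=> _; exact: ltW (lt_le_trans x0 y0).
Qed.

End barrier_width.

(** * Exponentially small survival below the critical width *)

Section survival_asymptotics.
Context {R : realType} (nu : probability R R) (b : nat) (theta s2 K4 : R).
Hypothesis b0 : (0 < b)%N.
Hypothesis theta0 : 0 < theta.
Hypothesis s20 : 0 < s2.
Hypothesis K40 : 0 <= K4.
Hypothesis tm : tilted_moments nu b theta s2 K4.

Definition critical_cube : R := 3 * pi ^+ 2 * s2 / (2 * theta).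

(* k ^+ 2 * s2 / 2 is the decay rate of the cosine of frequency k; here it is
   the midpoint of T and the critical rate pi ^+ 2 * s2 / 2. *)
Lemma intermediate_frequency (T : R) : 0 < T ->
  exists k, 0 < k /\ k ^+ 2 * s2 / 2 = (T + pi ^+ 2 * s2 / 2) / 2.
Proof.
move=> T0; have pi0 : 0 < pi :> R := pi_gt0 R.
have c0 : 0 < pi ^+ 2 * s2 / 2 by rewrite divr_gt0 ?mulr_gt0 ?exprn_gt0.
exists (Num.sqrt ((T + pi ^+ 2 * s2 / 2) / s2)).
rewrite sqr_sqrtr; last by rewrite ltW// divr_gt0// addr_gt0.
split; first by rewrite sqrtr_gt0 divr_gt0// addr_gt0.
by field; rewrite gt_eqF.
Qed.

(** The barrier is run at a larger subcritical slope l1. The level l N^2 then lies (l1 - l) N^2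
    below its top, and the factor exp(theta (z - w)) yields the decay. *)
Lemma survival_subcritical (l : R) : 0 < l -> l ^+ 3 < critical_cube ->
  exists C r, [/\ 0 < C, 0 < r & forall N : nat,
    survival nu b (N ^ 6) (l * N%:R ^+ 2) <= C * expR (- (r * N%:R ^+ 2))].
Proof.
move=> l0 lL; have [l1 ll1 l1L] := cube_room_above l0 lL.
have pi0 : 0 < pi :> R := pi_gt0 R.
have l10 : 0 < l1 := lt_trans l0 ll1.
(* Chosen so that the slope 3 T / theta of w^3 is l1^3. *)
pose T := theta * l1 ^+ 3 / 3; pose c0 : R := pi ^+ 2 * s2 / 2.
have T0 : 0 < T by rewrite divr_gt0// mulr_gt0// exprn_gt0.
have Tc0 : T < c0.
  move: l1L; rewrite /critical_cube ltr_pdivlMr ?mulr_gt0//.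
  by rewrite /T /c0; lra.
have [k [k0 kE]] := intermediate_frequency T0; rewrite -/c0 in kE.
have kpi : k < pi.
  rewrite -(@ltr_pXn2r _ 2) ?nnegrE ?ltW// -(ltr_pM2r s20).
  by move: kE Tc0; rewrite /c0; lra.
have [|W0 [c1 [W01 c10 step]]] := super_step theta0 s20 K40 tm k0 kpi T0.
  by rewrite kE; lra.
have c20 : 0 < cos (k / 2) by apply: cos_gt0_pihalf; apply/andP; split; lra.
(* The first summand gives C c1 >= 1, the second the bound at generation 0, where the survival
   probability is 1. *)
pose C := expR (theta * W0) * (c1^-1 + (cos (k / 2))^-1).
have eW1 : 1 <= expR (theta * W0).
  by rewrite -(expR0 R) ler_expR mulr_ge0 ?(ltW theta0)// (le_trans ler01).
have C0 : 0 < C by rewrite mulr_gt0 ?expR_gt0// addr_gt0 ?invr_gt0.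
have Cc1 : 1 <= C * c1.
  rewrite /C -mulrA mulrDl mulVf ?gt_eqF//.
  have : 0 <= (cos (k / 2))^-1 * c1 by rewrite mulr_ge0 ?invr_ge0 ?ltW.
  nra.
pose c := T / theta; pose w n := width c W0 n.
have c_0 : 0 <= c by rewrite divr_ge0// ltW.
have H n : super_bound nu b theta C k (w n) n.
  elim: n => [|n IH]; last by apply: step => //; exact: width_ge.
  move=> z /andP[z0 zw] /=; rewrite z0.
  have hcos : cos (k / 2) <= cos (phase k W0 z).
    apply: cos_norm_le_anti; last lra.
    have := @phase_norm R k W0 z 0 k0 (lt_le_trans ltr01 W01).
    by rewrite mul0r oppr0 !addr0 mul1r z0 => /(_ zw).
  apply: (@le_trans _ _ (C * expR (theta * (z - w 0%N)) * cos (k / 2))); last first.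
    by rewrite ler_wpM2l// mulr_ge0 ?expR_ge0// ltW.
  apply: (@le_trans _ _ (C * expR (- (theta * W0)) * cos (k / 2))); last first.
    rewrite ler_wpM2r ?(ltW c20)// ler_wpM2l ?(ltW C0)// ler_expR -mulrN.
    by rewrite ler_wpM2l ?(ltW theta0)// /w /=; lra.
  rewrite /C mulrAC expRN mulrC !mulrA mulVf ?gt_eqF ?expR_gt0// mul1r.
  rewrite mulrDl mulVf ?gt_eqF// lerDr mulr_ge0// ?invr_ge0 ltW//.
exists C, (theta * (l1 - l)); split => //; first by rewrite mulr_gt0// subr_gt0.
move=> N.
have n20 : 0 <= N%:R ^+ 2 :> R by rewrite sqr_ge0.
have wN : l1 * N%:R ^+ 2 <= w (N ^ 6)%N.
  apply: ler_cube.
    by rewrite (le_trans _ (width_ge _ _ c_0))// (le_trans ler01).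
  apply: le_trans (width_cube_ge _ c_0 W01).
  rewrite /c /T natrX exprMn -exprM le_eqVlt; apply/orP; left; apply/eqP.
  by field; rewrite gt_eqF.
have zz : 0 <= l * N%:R ^+ 2 <= w (N ^ 6)%N.
  rewrite mulr_ge0 ?(ltW l0)//= (le_trans _ wN)// ler_wpM2r// ltW//.
apply: (le_trans (H _ _ zz)).
apply: (@le_trans _ _ (C * expR (theta * (l * N%:R ^+ 2 - w (N ^ 6)%N)))).
  by rewrite ler_piMr ?cos_le1// mulr_ge0 ?expR_ge0// ltW.
rewrite ler_wpM2l ?(ltW C0)// ler_expR -mulrA -mulrN ler_wpM2l ?(ltW theta0)//.
by lra.
Qed.

End survival_asymptotics.

(** * A weak lower bound above the critical width *)

Section survival_supercritical_weak_bound.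
Context {R : realType} (nu : probability R R) (b : nat) (theta s2 K4 : R).
Hypothesis b0 : (0 < b)%N.
Hypothesis theta0 : 0 < theta.
Hypothesis s20 : 0 < s2.
Hypothesis K40 : 0 <= K4.
Hypothesis tm : tilted_moments nu b theta s2 K4.

(** The prefactor has to stay constant along the recursion and yet be O(w_j^-2) at every generation
    j <= n. It is fixed in advance at its smallest value a / w_n^2, which loses only a power of
    w_n. *)
Lemma sub_bound_width k T (l1 l2 : R) : pi < k -> k * 2 <= 3 * pi ->
  k ^+ 2 * s2 / 2 < T -> 3 * (T / theta) <= l2 ^+ 3 -> l2 ^+ 3 < l1 ^+ 3 ->
  exists W a, [/\ 1 <= W, 0 < a & forall n,
    exists w, [/\ 1 <= w, w ^+ 3 <= W ^+ 3 + l1 ^+ 3 * n%:R &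
      sub_bound nu b theta (a / w ^+ 2) k w n]].
Proof.
move=> pik kpi kT Tl2 l21.
have [W0 [W01 step]] := sub_step b0 theta0 s20 K40 tm pik kpi kT.
pose c := T / theta.
have T0 : 0 < T.
  by apply: le_lt_trans kT; rewrite divr_ge0// mulr_ge0 ?sqr_ge0// ltW.
have c0 : 0 < c by rewrite divr_gt0.
have d0 : 0 < l1 ^+ 3 - l2 ^+ 3 by rewrite subr_gt0.
have e0 : 0 < 3 * c ^+ 2 + c ^+ 3.
  by apply: addr_gt0; [apply: mulr_gt0|]; rewrite ?exprn_gt0.
(* Large enough for the excess slope in [width_cube_le] to fit between l2^3 and l1^3. *)
pose W := W0 + (3 * c ^+ 2 + c ^+ 3) / (l1 ^+ 3 - l2 ^+ 3).
have W0W : W0 <= W by rewrite lerDl divr_ge0// ltW.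
have W1 : 1 <= W := le_trans W01 W0W.
have Wpos : 0 < W := lt_le_trans ltr01 W1.
(* The first bound is required by [sub_step]; 1/2 settles generation 0, as the raised cosine is at
   most 2. *)
pose a := Num.min ((T - k ^+ 2 * s2 / 2) / 8) 2^-1.
have a0 : 0 < a by rewrite lt_min invr_gt0 ltr0n andbT divr_gt0// subr_gt0.
exists W, a; split => // n; pose w := width c W.
have Ww j : W <= w j := width_ge W j (ltW c0).
have w1 j : 1 <= w j := le_trans W1 (Ww j).
have wpos j : 0 < w j := lt_le_trans ltr01 (w1 j).
exists (w n); split => //.
  apply: (le_trans (width_cube_le n (ltW c0) W1)); rewrite lerD2l ler_wpM2r//.
  have : (3 * c ^+ 2 + c ^+ 3) / W <= l1 ^+ 3 - l2 ^+ 3.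
    by rewrite ler_pdivrMr// (mulrC _ W) -ler_pdivrMr// /W lerDr (le_trans ler01).
  by rewrite /c in Tl2 *; lra.
set A := a / w n ^+ 2.
have A0 : 0 <= A by rewrite divr_ge0 ?sqr_ge0// ltW.
have Aw j : (j <= n)%N -> A <= a / w j ^+ 2.
  move=> jn; rewrite ler_wpM2l ?(ltW a0)// lef_pV2 ?posrE ?exprn_gt0//.
  by rewrite lerXn2r ?nnegrE ?(ltW (wpos _))// width_nd// ltW.
suff H j : (j <= n)%N -> sub_bound nu b theta A k (w j) j by exact: H.
elim: j => [_|j IH jn].
  move=> z /andP[z0 zw] /=; rewrite z0.
  have A12 : A <= 2^-1.
    apply: (le_trans (Aw _ (leq0n n))); rewrite ler_pdivrMr ?exprn_gt0//.
    have h1 : 1 <= w 0%N ^+ 2 by rewrite exprn_ege1.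
    have h2 : a <= 2^-1 by rewrite ge_min lexx orbT.
    by lra.
  have e1 : expR (theta * (z - w 0%N)) <= 1.
    by rewrite expR_le1 pmulr_rle0// subr_le0.
  have : A * expR (theta * (z - w 0%N)) <= 2^-1.
    by apply: le_trans A12; rewrite ler_piMr.
  have := raised_cos_le2 k (w 0%N) z.
  have : 0 <= A * expR (theta * (z - w 0%N)) by rewrite mulr_ge0 ?expR_ge0.
  move: (A * _) (raised_cos _ _ _) => p q p0 q2 p1.
  have [q0|q0] := leP q 0; first by apply: le_trans ler01; rewrite mulr_ge0_le0.
  by apply: (@le_trans _ _ (2^-1 * 2)); [apply: ler_pM => //; exact: ltW|rewrite mulVf].
apply: step; rewrite ?(le_trans W0W)//; last by apply: IH; exact: ltnW.
apply: (le_trans (Aw _ (ltnW jn))); rewrite ler_wpM2r ?invr_ge0 ?sqr_ge0//.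
by rewrite ge_min lexx.
Qed.

Lemma survival_supercritical_weak (l dl : R) : 0 < l -> critical_cube theta s2 < l ^+ 3 -> 0 < dl ->
  exists N0, forall N : nat, (N0 <= N)%N ->
    expR (- (dl * N%:R ^+ 2)) <= survival nu b (N ^ 6) (l * N%:R ^+ 2).
Proof.
move=> l0 lL dl0.
have pi0 : 0 < pi :> R := pi_gt0 R.
have L0 : 0 < critical_cube theta s2.
  by rewrite divr_gt0 ?mulr_gt0 ?exprn_gt0.
have [l1 [l10 l1l l1L]] := cube_room_below (ltW L0) l0 lL.
have [l2 [l20 l2l l2L]] := cube_room_below (ltW L0) l10 l1L.
pose c0 : R := pi ^+ 2 * s2 / 2.
have c00 : 0 < c0 by rewrite divr_gt0 ?mulr_gt0 ?exprn_gt0.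
(* The cap 2 c0 gives k^2 <= 3 pi^2 / 2, hence k <= 3 pi / 2. *)
pose T := Num.min (theta * l2 ^+ 3 / 3) (2 * c0).
have Tc0 : c0 < T.
  rewrite lt_min; apply/andP; split; last lra.
  move: l2L; rewrite /critical_cube ltr_pdivrMr ?mulr_gt0//.
  by rewrite /c0; lra.
have T0 : 0 < T := lt_trans c00 Tc0.
have T2 : T <= 2 * c0 by rewrite ge_min lexx orbT.
have Tl2 : 3 * (T / theta) <= l2 ^+ 3.
  have : T <= theta * l2 ^+ 3 / 3 by rewrite ge_min lexx.
  by rewrite mulrA ler_pdivrMr//; lra.
have [k [k0 kE]] := intermediate_frequency s20 T0; rewrite -/c0 in kE.
have kpi : pi < k.
  rewrite -(@ltr_pXn2r _ 2) ?nnegrE ?ltW// -(ltr_pM2r s20).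
  by move: kE Tc0; rewrite /c0; lra.
have k3pi : k * 2 <= 3 * pi.
  rewrite -(@ler_pXn2r _ 2) ?nnegrE ?mulr_ge0 ?(ltW k0) ?(ltW pi0)// !exprMn -(ler_pM2r s20).
  by move: kE T2; rewrite /c0; lra.
have kT : k ^+ 2 * s2 / 2 < T by rewrite kE; lra.
have l21 : l2 ^+ 3 < l1 ^+ 3 by rewrite ltrXn2r// ?nnegrE ?ltW.
have [W [a [W1 a0 H]]] := sub_bound_width kpi k3pi kT Tl2 l21.
(* The raised cosine vanishes at z = w, so the bound is read at (1 - e) w. The exponential then
   costs at most half of the allowance dl N^2. *)
pose e := Num.min 4^-1 (dl / (2 * theta * l)).
have e0 : 0 < e by rewrite lt_min invr_gt0 ltr0n/= divr_gt0// !mulr_gt0.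
have e4 : e <= 4^-1 by rewrite ge_min lexx.
have edl : theta * e * l <= dl / 2.
  have : e <= dl / (2 * theta * l) by rewrite ge_min lexx orbT.
  rewrite ler_pdivlMr ?mulr_gt0//; lra.
pose p := cos (k * (2^-1 - e)) - cos (k / 2).
have p0 : 0 < p.
  have ke : 0 < k * e by rewrite mulr_gt0.
  have ke4 : k * e <= k / 4 by rewrite ler_wpM2l// ltW.
  rewrite subr_gt0 ltr_cos ?in_itv/= ?ltr_pM2l//.
  - by rewrite gtrBl.
  - by apply/andP; split; lra.
  - by apply/andP; split; lra.
have l13 : 0 < l ^+ 3 - l1 ^+ 3 by rewrite subr_gt0 ltrXn2r// ?nnegrE ltW.
pose X1 := W ^+ 3 / (l ^+ 3 - l1 ^+ 3).
(* The other half covers the factor a p / w^2, through y^3 / 6 <= exp y at y = dl N^2 / 2; 48 is 6 *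
   2^3. *)
pose X2 := 48 * l ^+ 2 / (a * p * dl ^+ 3).
have X10 : 0 <= X1.
  by apply: divr_ge0; [rewrite exprn_ge0// (le_trans ler01)|exact: ltW].
have X20 : 0 <= X2.
  apply: divr_ge0; first by rewrite mulr_ge0 ?sqr_ge0.
  by apply: mulr_ge0; [apply: mulr_ge0; exact: ltW|rewrite exprn_ge0// ltW].
pose X := X1 + X2.
exists (Num.truncn X).+1 => N N0N.
have XN : X <= N%:R.
  by apply: (le_trans (ltW (truncnS_gt X))); rewrite ler_nat.
have N1 : (1 <= N)%N by rewrite (leq_trans _ N0N).
have N1R : 1 <= N%:R :> R by rewrite ler1n.
have NR0 : 0 < N%:R :> R by rewrite ltr0n.
have t1 : X1 <= N%:R by apply: le_trans XN; rewrite lerDl.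
have t2 : X2 <= N%:R by apply: le_trans XN; rewrite lerDr.
have [w [w1 w3 Hw]] := H (N ^ 6)%N.
have w0 : 0 < w := lt_le_trans ltr01 w1.
have Npow m : N%:R <= N%:R ^+ m.+1 :> R by rewrite -[leLHS]expr1 ler_weXn2l.
have wl : w <= l * N%:R ^+ 2.
  apply: ler_cube; first by rewrite mulr_ge0 ?sqr_ge0// ltW.
  apply: (le_trans w3); rewrite natrX exprMn -exprM.
  have : W ^+ 3 <= (l ^+ 3 - l1 ^+ 3) * N%:R ^+ 6.
    by rewrite mulrC -ler_pdivrMr// (le_trans t1).
  by lra.
have z01 : 0 <= (1 - e) * w <= w.
  have e1 : 0 <= 1 - e <= 1.
    by rewrite subr_ge0 gerBl (ltW e0) (le_trans e4)// invf_le1// ler1n.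
  by case/andP: e1 => e1 e1'; rewrite mulr_ge0 ?(ltW w0)//= ler_piMl ?(ltW w0).
apply: (@le_trans _ _ (survival nu b (N ^ 6) ((1 - e) * w))); last first.
  by apply: survival_nd; case/andP: z01 => _ /le_trans; apply.
apply: le_trans (Hw _ z01).
have -> : raised_cos k w ((1 - e) * w) = p.
  by rewrite /raised_cos /phase mulfK ?gt_eqF//; congr (cos (k * _) - _); field.
have -> : (1 - e) * w - w = - (e * w) by ring.
set M := N%:R ^+ 2 : R.
have M0 : 0 < M by rewrite exprn_gt0.
have h1 : expR (- (dl / 2 * M)) <= expR (theta * - (e * w)).
  rewrite ler_expR mulrN lerN2 mulrA.
  apply: (@le_trans _ _ (theta * e * (l * M))); first by rewrite ler_wpM2l// mulr_ge0// ltW.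
  by rewrite mulrA ler_wpM2r// ltW.
have h2 : expR (- (dl / 2 * M)) <= a * p / w ^+ 2.
  have y0 : 0 < dl / 2 * M by rewrite mulr_gt0// divr_gt0.
  have y3 : (dl / 2 * M) ^+ 3 / 6 <= expR (dl / 2 * M).
    by apply: le_trans (expR_ge1Dxn 2 (ltW y0)); rewrite lerDr.
  rewrite expRN -[leRHS]invrK lef_pV2 ?posrE ?invr_gt0 ?divr_gt0 ?mulr_gt0 ?exprn_gt0 ?expR_gt0//.
  apply: le_trans y3; rewrite invf_div ler_pdivrMr ?mulr_gt0//.
  have wM : w ^+ 2 <= l ^+ 2 * M ^+ 2.
    by rewrite -exprMn lerXn2r ?nnegrE ?mulr_ge0 ?(ltW w0) ?(ltW l0) ?(ltW M0).
  apply: (le_trans wM).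
  have : 48 * l ^+ 2 <= a * p * dl ^+ 3 * M.
    move: t2; rewrite /X2 ler_pdivrMr ?mulr_gt0 ?exprn_gt0// => /le_trans; apply.
    by rewrite mulrC ler_wpM2l ?mulr_ge0 ?exprn_ge0 ?(ltW a0) ?(ltW p0) ?(ltW dl0)// /M.
  have : 0 <= M ^+ 2 by rewrite sqr_ge0.
  move=> M2 /(ler_wpM2r M2).
  have -> : 48 * l ^+ 2 * M ^+ 2 = 48 * (l ^+ 2 * M ^+ 2) by ring.
  have -> : a * p * dl ^+ 3 * M * M ^+ 2 = 48 * ((dl / 2 * M) ^+ 3 / 6 * (a * p)) by field.
  by rewrite ler_pM2l.
have -> : dl * M = dl / 2 * M + dl / 2 * M by field.
rewrite opprD expRD.
have -> : a / w ^+ 2 * expR (theta * - (e * w)) * p =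
  a * p / w ^+ 2 * expR (theta * - (e * w)) by ring.
by apply: ler_pM; rewrite ?expR_ge0.
Qed.

End survival_supercritical_weak_bound.

(** * Boosting a survival probability by branching *)

Section boosting.
Context {R : realType} (nu : probability R R) (b : nat).
Hypothesis b2 : (2 <= b)%N.

Lemma conv_shift q z (M h : R) : survival_like q ->
  (nu [set x | (M < x)%R] <= h%:E)%E -> (1 - h) * q z <= conv nu q (z + M).
Proof.
move=> qq nuM; have q0 y : 0 <= q y by case: qq => _ /(_ y) /andP[].
have mM : measurable [set x : R | x <= M].
  by rewrite -[X in measurable X]setTI; apply: measurable_fun_le => //.
have h1 : 1 - h <= fine (nu [set x | x <= M]).
  have -> : [set x | x <= M] = ~` [set x | M < x].
    by apply/seteqP; split=> x /=; [move=> ?; apply/negP; rewrite -leNgt|move/negP; rewrite -leNgt].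
  have mM' : measurable [set x : R | M < x].
    rewrite (_ : [set x | M < x] = ~` [set x | x <= M]); first exact: measurableC.
    by apply/seteqP; split=> x /=; [move=> ?; apply/negP; rewrite -ltNge|move/negP; rewrite -ltNge].
  rewrite probability_setC// fineB ?fin_num_measure//= lerD2l lerN2.
  by rewrite -lee_fin fineK ?fin_num_measure.
apply: (le_trans (ler_wpM2r (q0 z) h1)); rewrite mulrC.
have -> : fine (nu [set x | x <= M]) = \int[nu]_x (\1_[set x | x <= M] x : R).
  by rewrite /Rintegral integral_indic// setIT.
have I1 : nu.-integrable setT (EFin \o (\1_[set x | x <= M] : R -> R)).
  by apply: integrable_indic => //; rewrite (le_lt_trans (probability_le1 _ _))// ltry.
rewrite -RintegralZl//; apply: le_Rintegral => //.
- exact: (integrableZl measurableT (q z) I1).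
- exact: survival_like_integrable.
move=> x _; rewrite indicE; have [xM|xM] := boolP (x \in [set x | x <= M]).
  rewrite mulr1; case: qq => + _; apply; move: xM; rewrite inE/= => xM; lra.
by rewrite mulr0.
Qed.

(** Only two children are kept, each surviving with probability at least (1 - h) s: its edge is at
    most M except with probability h, and raising the level by M pays for it. *)
Lemma survival_shift n z (M h s : R) : 0 <= z -> 0 <= M -> 0 <= s -> 0 <= h -> h <= 1 ->
  (nu [set x | (M < x)%R] <= h%:E)%E -> s <= survival nu b n z ->
  1 - (1 - (1 - h) * s) ^+ 2 <= survival nu b n.+1 (z + M).
Proof.
move=> z0 M0 s0 h0 h1 nuM sz.
have ok := survival_like_survival nu b n.
have s1 := le_trans sz (survival_le1 nu b n z).
rewrite survivalS /branch_step addr_ge0//.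
have hs0 : 0 <= (1 - h) * s by rewrite mulr_ge0// subr_ge0.
have hs : (1 - h) * s <= conv nu (survival nu b n) (z + M).
  by apply: le_trans (conv_shift z ok nuM); rewrite ler_wpM2l// subr_ge0.
have c1 := conv_le1 nu (z + M) ok.
apply: le_trans (one_sub_exp_le b hs0 hs c1).
rewrite lerD2l lerN2 ler_wiXn2l//; first by rewrite subr_ge0 (le_trans hs).
by rewrite gerBl.
Qed.

(** For s <= 3/4 and h <= 1/20 a generation multiplies s by at least 1.9 - 0.9025 * 3/4 > 11/10; the
    minimum stops the growth where this range ends. *)
Lemma boost_growth n z (M h p : R) j : 0 <= z -> 0 <= M -> 0 <= h -> h <= 20^-1 ->
  (nu [set x | (M < x)%R] <= h%:E)%E -> 0 <= p -> p <= survival nu b n z ->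
  Num.min (3 / 4) ((11 / 10) ^+ j * p) <= survival nu b (n + j) (z + j%:R * M).
Proof.
move=> z0 M0 h0 h20 nuM p0 pz; elim: j => [|j IH].
  by rewrite addn0 mul0r addr0 expr0 mul1r ge_min pz orbT.
have s0 : 0 <= Num.min (3 / 4) ((11 / 10) ^+ j * p).
  by rewrite le_min divr_ge0//= mulr_ge0// exprn_ge0// divr_ge0.
have z0' : 0 <= z + j%:R * M by rewrite addr_ge0// mulr_ge0.
have h1 : h <= 1 by lra.
have := survival_shift z0' M0 s0 h0 h1 nuM IH.
have -> : z + j.+1%:R * M = z + j%:R * M + M by rewrite -natr1; ring.
rewrite addnS; apply: le_trans.
have s34 : Num.min (3 / 4) ((11 / 10) ^+ j * p) <= 3 / 4 by rewrite ge_min lexx.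
have : Num.min (3 / 4) ((11 / 10) ^+ j.+1 * p) <= 11 / 10 * Num.min (3 / 4) ((11 / 10) ^+ j * p).
  rewrite exprS -mulrA [in leRHS]/Num.min; case: ifP => _.
    by rewrite ge_min; apply/orP; left; lra.
  by rewrite ge_min lexx orbT.
move/le_trans; apply.
move: (Num.min _ _) s0 s34 => s s0 s34.
have hs : 0 <= h * s by rewrite mulr_ge0.
have hs2 : h * s <= s / 20 by rewrite mulrC ler_wpM2l.
have ss : s * s <= 3 / 4 * s by rewrite ler_wpM2r.
have : 0 <= h * (s * s) by rewrite !mulr_ge0.
have : h * h * (s * s) <= h * (s * s).
  by rewrite -mulrA ler_piMl ?mulr_ge0.
nra.
Qed.

(** A generation squares the failure probability after adding at most h. The form t / 4 + 2 h is
    stable, since (t / 4 + 3 h)^2 <= t / 16 + 39 h / 20 for t <= 1. *)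
Lemma boost_decay n z (M h : R) i : 0 <= z -> 0 <= M -> 0 <= h -> h <= 20^-1 ->
  (nu [set x | (M < x)%R] <= h%:E)%E -> 3 / 4 <= survival nu b n z ->
  1 - survival nu b (n + i) (z + i%:R * M) <= 4^-1 * 2^-1 ^+ i + 2 * h.
Proof.
move=> z0 M0 h0 h20 nuM nz; elim: i => [|i IH].
  by rewrite addn0 mul0r addr0 expr0; lra.
have z0' : 0 <= z + i%:R * M by rewrite addr_ge0// mulr_ge0.
have h1 : h <= 1 by lra.
have hs := survival_ge0 nu b (n + i) (z + i%:R * M).
have := survival_shift z0' M0 hs h0 h1 nuM (lexx _).
have -> : z + i.+1%:R * M = z + i%:R * M + M by rewrite -natr1; ring.
rewrite addnS.
have hs1 := survival_le1 nu b (n + i) (z + i%:R * M).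
move: (survival _ _ _ _) (survival _ _ _ _) hs hs1 IH => s' s s0 s1 IH h2.
have t0 : 0 <= 2^-1 ^+ i :> R by rewrite exprn_ge0// invr_ge0.
have t1 : 2^-1 ^+ i <= 1 :> R by rewrite exprn_ile1// ?invr_ge0// invf_le1// ler1n.
rewrite exprS; move: (2^-1 ^+ i) t0 t1 IH => t t0 t1 IH.
have hs : 0 <= h * s by rewrite mulr_ge0.
have hs2 : h * s <= h by rewrite ler_piMr.
have u0 : 0 <= 1 - (1 - h) * s by lra.
have u1 : 1 - (1 - h) * s <= 4^-1 * t + 3 * h by lra.
have : (1 - (1 - h) * s) ^+ 2 <= (4^-1 * t + 3 * h) ^+ 2 by rewrite lerXn2r// nnegrE; lra.
have : t * t <= t by rewrite ler_piMl.
have : h * t <= h by rewrite ler_piMr.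
have : h * h <= h / 20 by rewrite mulrC ler_wpM2l// ; lra.
nra.
Qed.

End boosting.

(** * Survival probability close to one above the critical width *)

Section supercritical.
Context {R : realType} (nu : probability R R) (b : nat) (theta s2 K4 Ct lt : R).
Hypothesis b2 : (2 <= b)%N.
Hypothesis theta0 : 0 < theta.
Hypothesis s20 : 0 < s2.
Hypothesis K40 : 0 <= K4.
Hypothesis tm : tilted_moments nu b theta s2 K4.
Hypothesis lt0 : 0 < lt.
Hypothesis Ct0 : 0 < Ct.
Hypothesis tail : forall t : R, (nu [set x | (t < x)%R] <= (Ct * expR (- (lt * t)))%:E)%E.

Lemma tail_small (e : R) : 0 < e -> exists2 M0, 0 <= M0 &
  forall M, M0 <= M -> Ct * expR (- (lt * M)) <= e.
Proof.
move=> e0; exists (Ct / (e * lt)); first by apply: divr_ge0; [|apply: mulr_ge0]; exact: ltW.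
move=> M; rewrite ler_pdivrMr ?mulr_gt0// => h.
rewrite expRN ler_pdivrMr ?expR_gt0//.
have : 1 + lt * M <= expR (lt * M) by exact: expR_ge1Dx.
move=> /(ler_wpM2l (ltW e0)); lra.
Qed.

(** The gap l - l1 = 3 g is spent in thirds: two on about 11 dl N^2 generations with steps up to
    [M0], rounding included, and one on N generations with steps up to g N. *)
Lemma survival_supercritical (l : R) : 0 < l -> critical_cube theta s2 < l ^+ 3 ->
  exists C r N0, [/\ 0 < C, 0 < r & forall N : nat, (N0 <= N)%N ->
    1 - survival nu b (N ^ 6) (l * N%:R ^+ 2) <= C * expR (- (r * N%:R))].
Proof.
move=> l0 lL; have b0 : (0 < b)%N by rewrite (leq_trans _ b2).
have pi0 : 0 < pi :> R := pi_gt0 R.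
have L0 : 0 < critical_cube theta s2 by rewrite divr_gt0 ?mulr_gt0 ?exprn_gt0.
have [l1 [l10 l1l l1L]] := cube_room_below (ltW L0) l0 lL.
have e20 : 0 < 20^-1 :> R by rewrite invr_gt0.
have [M0 M00 tM0] := tail_small e20.
pose g := (l - l1) / 3; have g0 : 0 < g by rewrite divr_gt0// subr_gt0.
(* As exp(1/11) <= 11/10, undoing exp(- dl S) takes 11 dl S generations, which raise the level by at
   most g S up to rounding. *)
pose dl := g / (11 * (M0 + 1)).
have M10 : 0 < 11 * (M0 + 1) by rewrite mulr_gt0// ltr_wpDl.
have dl0 : 0 < dl by rewrite divr_gt0.
have [N1 HN1] := survival_supercritical_weak b0 theta0 s20 K40 tm l10 l1L dl0.
pose r := Num.min 2^-1 (lt * g).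
have r0 : 0 < r by rewrite lt_min invr_gt0 ltr0n/= mulr_gt0.
pose X := M0 / g; have X0 : 0 <= X by rewrite divr_ge0// ltW.
exists (1 + 2 * Ct), r, (N1 + (Num.truncn X).+1)%N; split => //.
  by rewrite addr_gt0// mulr_gt0.
move=> N NN.
have NN1 : (N1 <= N)%N by rewrite (leq_trans _ NN)// leq_addr.
have XN : X <= N%:R.
  apply: (le_trans (ltW (truncnS_gt X))); rewrite ler_nat.
  by rewrite (leq_trans _ NN)// leq_addl.
have N1R : 1 <= N%:R :> R.
  by rewrite ler1n (leq_trans _ NN)// addnS.
have NR0 : 0 < N%:R :> R := lt_le_trans ltr01 N1R.
have M0N : M0 <= g * N%:R by move: XN; rewrite /X ler_pdivrMr// mulrC.
set S := N%:R ^+ 2 : R.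
have NS : N%:R <= S by exact: sqr_large.
have S0 : 0 < S := lt_le_trans NR0 NS.
pose j := (Num.truncn (11 * dl * S)).+1.
have j1 : 11 * dl * S <= j%:R by exact: ltW (truncnS_gt _).
have j2 : j%:R <= 11 * dl * S + 1.
  have dS : 0 <= 11 * dl * S by apply: mulr_ge0; [apply: mulr_ge0|]; rewrite ?ltW.
  by rewrite /j -(natr1 (Num.truncn _)) lerD2r; have /andP[] := truncn_itv dS.
have p0 := expR_ge0 (- (dl * S)).
have zz : 0 <= l1 * S by rewrite mulr_ge0 ?ltW.
have tail20 : (nu [set x | (M0 < x)%R] <= (20^-1)%:E)%E.
  by apply: (le_trans (tail M0)); rewrite lee_fin tM0.
have grow := boost_growth b2 j zz M00 (ltW e20) (lexx _) tail20 p0 (HN1 N NN1).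
have big : 3 / 4 <= survival nu b (N ^ 6 + j) (l1 * S + j%:R * M0).
  apply: le_trans grow; rewrite le_min lexx/=.
  have h1 : expR (dl * S) <= (11 / 10) ^+ j.
    have h11 : expR (11^-1) <= 11 / 10 :> R.
      rewrite -[leLHS]invrK -expRN -[leRHS]invrK lef_pV2 ?posrE ?expR_gt0 ?invr_gt0 ?divr_gt0//.
      by rewrite invf_div; apply: le_trans (expR_ge1Dx _); lra.
    apply: (@le_trans _ _ (expR (11^-1) ^+ j)); last first.
      by rewrite lerXn2r ?nnegrE ?expR_ge0 ?divr_ge0.
    rewrite -expRM_natl ler_expR; move: j1; lra.
  have : expR (dl * S) * expR (- (dl * S)) <= (11 / 10) ^+ j * expR (- (dl * S)).
    by rewrite ler_wpM2r.
  by rewrite -expRD subrr expR0; lra.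
pose M := g * N%:R; have Mge0 : 0 <= M by rewrite mulr_ge0 ?ltW.
have h20 := tM0 _ M0N.
have h00 : 0 <= Ct * expR (- (lt * M)) by rewrite mulr_ge0 ?expR_ge0 ?ltW.
have z2 : 0 <= l1 * S + j%:R * M0 by rewrite addr_ge0// mulr_ge0.
have dec := boost_decay b2 N z2 Mge0 h00 h20 (tail _) big.
have jM0 : j%:R * M0 <= g * S + g * S.
  have h1 : j%:R * M0 <= (11 * dl * S + 1) * M0 by rewrite ler_wpM2r.
  have h2 : 11 * dl * M0 <= g.
    have -> : 11 * dl * M0 = g * (M0 / (M0 + 1)).
      by rewrite /dl; field; rewrite gt_eqF// ltr_wpDl.
    by rewrite ler_piMr ?(ltW g0)// ler_pdivrMr ?ltr_wpDl// mul1r lerDl.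
  have h3 : 11 * dl * M0 * S <= g * S by rewrite ler_wpM2r// ltW.
  have h4 : g * N%:R <= g * S by rewrite ler_wpM2l// ltW.
  lra.
have pos : l1 * S + j%:R * M0 + N%:R * M <= l * S.
  have -> : N%:R * M = g * S by rewrite /M /S; ring.
  have -> : l = l1 + 3 * g by rewrite /g; field.
  lra.
(* The additional generations do no harm: survival decreases with the number of generations. *)
have mono : survival nu b (N ^ 6 + j + N) (l1 * S + j%:R * M0 + N%:R * M) <=
    survival nu b (N ^ 6) (l * S).
  apply: (le_trans (survival_nd _ _ _ pos)); apply: survival_anti.
  by rewrite -addnA leq_addr.
have e1 : 2^-1 ^+ N <= expR (- (r * N%:R)).
  apply: (@le_trans _ _ (expR (- 2^-1) ^+ N)).
    rewrite lerXn2r ?nnegrE ?invr_ge0 ?expR_ge0//.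
    by apply: le_trans (expR_ge1Dx _); lra.
  rewrite -expRM_natl ler_expR.
  have : r * N%:R <= 2^-1 * N%:R by rewrite ler_wpM2r// ge_min lexx.
  lra.
have e2 : expR (- (lt * M)) <= expR (- (r * N%:R)).
  by rewrite ler_expR lerN2 /M mulrA ler_wpM2r// ge_min lexx orbT.
have e3 : Ct * expR (- (lt * M)) <= Ct * expR (- (r * N%:R)) by rewrite ler_wpM2l// ltW.
have e4 : 0 <= 2^-1 ^+ N :> R by rewrite exprn_ge0// invr_ge0.
lra.
Qed.

End supercritical.

(** * Independence *)

Section generated_sigma_algebras.
Context d (T : measurableType d) (R : realType) (P : probability T R) (I : eqType)
  (X : I -> {RV P >-> R}).
Hypothesis X_indep : mutually_independent X.
Implicit Types (S : set I) (s : seq I).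

(** Finite intersections instead of single preimages, so that these generators form a pi-system. *)
Definition cylinders S : set (set T) := [set A | exists s (B : I -> set R),
  [/\ uniq s, (forall i, i \in s -> S i), (forall i, measurable (B i)) &
    A = \big[setI/setT]_(i <- s) (X i @^-1` B i)]].

Lemma measurable_preimage i (B : set R) : measurable B -> measurable (X i @^-1` B).
Proof. by move=> mB; rewrite -[X in measurable X]setTI; exact: measurable_funP. Qed.

Lemma cylinders_measurable S : cylinders S `<=` measurable.
Proof.
move=> _ [s [B [_ _ mB ->]]].
by apply: big_ind => //; [exact: measurableI|move=> i _; exact: measurable_preimage].
Qed.

Lemma cylindersT S : cylinders S setT.
Proof. by exists [::], (fun=> setT); split; rewrite ?big_nil. Qed.

Lemma cylinders_setI S : setI_closed (cylinders S).
Proof.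
move=> _ _ [s [B [us sS mB ->]]] [t [C [ut tS mC ->]]].
exists (undup (s ++ t)), (fun i => (if i \in s then B i else setT) `&`
                                  (if i \in t then C i else setT)).
split.
- exact: undup_uniq.
- by move=> i; rewrite mem_undup mem_cat => /orP[/sS|/tS].
- by move=> i; apply: measurableI; case: ifP.
rewrite big_split/=.
have aux (r : seq I) (D : I -> set R) : {subset r <= s ++ t} -> uniq r ->
    \big[setI/setT]_(i <- undup (s ++ t)) (X i @^-1` (if i \in r then D i else setT)) =
    \big[setI/setT]_(i <- r) (X i @^-1` D i).
  move=> rst ur; rewrite (bigID (mem r))/= [X in _ `&` X]big1 ?setIT; last first.
    by move=> i /negbTE ->.
  rewrite -big_filter (perm_big r).
    by apply: eq_big_seq => i ->.
  apply: uniq_perm => //; first by rewrite filter_uniq// undup_uniq.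
  move=> i; rewrite mem_filter mem_undup; have [ir|//] := boolP (i \in r).
  by rewrite rst.
by rewrite !aux// => i; rewrite mem_cat => ->; rewrite ?orbT.
Qed.

Lemma cylinders_sub S S' : S `<=` S' -> cylinders S `<=` cylinders S'.
Proof. by move=> SS' _ [s [B [? sS ? ->]]]; exists s, B; split => // i /sS/SS'. Qed.

Lemma cylinders_indep S S' A A' : S `&` S' = set0 ->
  cylinders S A -> cylinders S' A' -> (P (A `&` A') = P A * P A')%E.
Proof.
move=> SS0 [s [B [us sS mB ->]]] [t [C [ut tS mC ->]]].
have st i : i \in s -> i \in t -> False.
  by move=> /sS Si /tS S'i; rewrite -[False]/(set0 i) -SS0.
pose D i := if i \in s then B i else C i.
have -> : \big[setI/setT]_(i <- s) (X i @^-1` B i) = \big[setI/setT]_(i <- s) (X i @^-1` D i).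
  by apply: eq_big_seq => i si; rewrite /D si.
have -> : \big[setI/setT]_(i <- t) (X i @^-1` C i) = \big[setI/setT]_(i <- t) (X i @^-1` D i).
  by apply: eq_big_seq => i ti; rewrite /D; case: ifPn => // /st /(_ ti).
have mD i : measurable (D i) by rewrite /D; case: ifP.
rewrite -big_cat/= !X_indep//; last first.
  rewrite cat_uniq us ut andbT/=; apply/hasPn => i it; apply/negP => si.
  exact: st si it.
by rewrite big_cat.
Qed.

Definition sigma_gen S : set (set T) := <<s cylinders S >>.

Lemma sigma_gen_measurable S : sigma_gen S `<=` measurable.
Proof.
apply: smallest_sub; first exact: sigma_algebra_measurable.
exact: cylinders_measurable.
Qed.

Lemma sigma_gen_sub S S' : S `<=` S' -> sigma_gen S `<=` sigma_gen S'.
Proof. by move=> SS'; apply: sub_sigma_algebra2; exact: cylinders_sub. Qed.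

(** Uniqueness of measures, applied once per factor: for fixed E, the restriction of P to E and P
    scaled by P E are finite measures that agree on the pi-system of cylinders. *)
Lemma sigma_gen_indep S S' A A' : S `&` S' = set0 ->
  sigma_gen S A -> sigma_gen S' A' -> (P (A `&` A') = P A * P A')%E.
Proof.
move=> SS0 SA SA'.
have mA := sigma_gen_measurable SA; have mA' := sigma_gen_measurable SA'.
have step (S1 : set I) (E : set T) (mE : measurable E) :
    (forall A, cylinders S1 A -> (P (A `&` E) = P A * P E)%E) ->
    forall A, sigma_gen S1 A -> (P (A `&` E) = P A * P E)%E.
  move=> h B S1B.
  have PEnng : (0 <= fine (P E))%R by exact: fine_ge0.
  have -> : (P B * P E = mscale (NngNum PEnng) P B)%E.
    by rewrite /mscale/= fineK ?fin_num_measure// muleC.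
  have -> : P (B `&` E) = mrestr P mE B by [].
  apply: (@g_sigma_algebra_measure_unique _ _ _ (cylinders S1) _ (fun=> setT)) => //.
  - exact: cylinders_measurable.
  - by move=> _; exact: cylindersT.
  - by rewrite bigcup_const.
  - exact: cylinders_setI.
  - move=> C S1C; rewrite -[LHS]/(P (C `&` E)) h//.
    by rewrite -[RHS]/((fine (P E))%:E * P C)%E fineK ?fin_num_measure// muleC.
  - move=> _; rewrite -[X in (X < _)%E]/(P (setT `&` E)) setTI.
    by rewrite (le_lt_trans (probability_le1 _ _))// ltry.
apply: (step S) => // {}A {SA mA} SA.
rewrite setIC muleC; have mA := cylinders_measurable SA.
apply: (step S') => // {}A' {SA' mA'} SA'.
by rewrite setIC muleC; exact: (cylinders_indep SS0).
Qed.

Lemma measurable_sigma_gen S i : S i ->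
  measurable_fun (setT : set (g_sigma_algebraType (cylinders S))) (X i).
Proof.
move=> Si _ B mB; rewrite setTI; apply: sub_sigma_algebra.
exists [:: i], (fun=> B); split => //; last by rewrite big_seq1.
by move=> j; rewrite inE => /eqP ->.
Qed.

Lemma sigma_gen_preimage S (f : T -> R) (B : set R) :
  measurable_fun (setT : set (g_sigma_algebraType (cylinders S))) f ->
  measurable B -> sigma_gen S (f @^-1` B).
Proof. by move=> mf mB; have := mf measurableT B mB; rewrite setTI. Qed.

Lemma measurable_fun_sigma_gen S (f : T -> R) :
  measurable_fun (setT : set (g_sigma_algebraType (cylinders S))) f ->
  measurable_fun (setT : set T) f.
Proof.
move=> mf _ B mB; rewrite setTI; apply: (@sigma_gen_measurable S).
exact: sigma_gen_preimage.
Qed.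

Lemma measurable_fun_sigma_gen_sub S S' (f : T -> R) : S `<=` S' ->
  measurable_fun (setT : set (g_sigma_algebraType (cylinders S))) f ->
  measurable_fun (setT : set (g_sigma_algebraType (cylinders S'))) f.
Proof.
move=> SS' mf _ B mB; rewrite setTI; apply: (sigma_gen_sub SS').
exact: sigma_gen_preimage.
Qed.

Lemma sigma_gen_indep_big (J : eqType) (r : seq J) (S : J -> set I) (A : J -> set T) :
  uniq r -> (forall i j, i != j -> S i `&` S j = set0) ->
  (forall j, sigma_gen (S j) (A j)) ->
  (P (\big[setI/setT]_(j <- r) A j) = \prod_(j <- r) P (A j))%E.
Proof.
move=> + Sdis SA; elim: r => [|j r IH]; first by rewrite !big_nil probability_setT.
move=> /= /andP[jr ur]; rewrite !big_cons -IH//.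
apply: (@sigma_gen_indep (S j) (fun e => exists2 k, k \in r & S k e)) => //.
  rewrite -subset0 => e [Sj [k kr Sk]].
  have jk : j != k by apply: contraNneq jr => ->.
  by rewrite -(Sdis _ _ jk).
rewrite big_seq; elim/big_ind : _ => //.
- exact: (@measurableT _ (g_sigma_algebraType (cylinders _))).
- by move=> B C; exact: (@measurableI _ (g_sigma_algebraType (cylinders _))).
- by move=> k kr; apply: (@sigma_gen_sub (S k)) (SA k) => e Sk; exists k.
Qed.

End generated_sigma_algebras.

Section sum_of_independent.
Context d (T : measurableType d) (R : realType) (P : probability T R).

(** Independence identifies the joint law with the product measure, whose value on a set is by
    definition the integral of its sections. *)
Lemma probability_add_indep (U V : {RV P >-> R}) (y : R) :
  (forall A B, measurable A -> measurable B ->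
    P (U @^-1` A `&` V @^-1` B) = (P (U @^-1` A) * P (V @^-1` B))%E) ->
  P [set w | (U w + V w <= y)%R] =
  (\int[distribution P U]_x P [set w | (V w <= y - x)%R])%E.
Proof.
move=> UV.
have mUV : measurable_fun setT (fun w => (U w, V w)).
  by apply: measurable_fun_pair; exact: measurable_funP.
pose UVm : {mfun T >-> (R * R)%type} :=
  HB.pack (fun w => (U w, V w)) (isMeasurableFun.Build _ _ _ _ _ mUV).
pose E : set (R * R) := [set p | p.1 + p.2 <= y].
have mE : measurable E.
  rewrite -[E]setTI; apply: measurable_fun_le => //.
  by apply: measurable_funD; [exact: measurable_fst|exact: measurable_snd].
have h := @product_measure_unique _ _ R R R (distribution P U) (distribution P V)
  (distribution P UVm) (fun A B mA mB => UV A B mA mB) E mE.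
rewrite -[LHS]/(distribution P UVm E) -h.
apply: eq_integral => x _ /=.
rewrite /distribution /pushforward; congr (P _); apply/seteqP; split=> w /=;
  by rewrite /xsection/= inE/= /E/= lerBrDl.
Qed.

End sum_of_independent.

(** * The law of the minimax along the tree *)

Section path_minimax.
Context {R : realType} {b : nat} (i0 : 'I_b) (m : R).
Implicit Types (x : edge b -> R) (v u : vertex b).

(** The 0 under the maximum is the contribution of the path's starting point. The default of the
    minimum is the value of the child [i0], which is in the range anyway, so the minimum remains
    real. *)
Fixpoint minimax n v x : R :=
  if n is n'.+1 then
    Num.max 0 (\big[Num.min/x (v, i0) - m + minimax n' (rcons v i0) x]_(i < b)
                 (x (v, i) - m + minimax n' (rcons v i) x))
  else 0.

Lemma minimax_leS n v x y : (minimax n.+1 v x <= y) =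
  (0 <= y) && [exists i, x (v, i) - m + minimax n (rcons v i) x <= y].
Proof.
rewrite /= ge_max; congr (_ && _); apply/bigmin_leP/existsP => [[h|[i _ h]]|[i h]].
- by exists i0.
- by exists i.
- by right; exists i.
Qed.

Lemma positionE x v : position x v = \sum_(0 <= j < size v) x (take j v, nth i0 v j).
Proof. by rewrite big_mkord; apply: eq_bigr => j _; rewrite (tnth_nth i0). Qed.

Lemma position_rcons x v i : position x (rcons v i) = position x v + x (v, i).
Proof.
rewrite !positionE size_rcons big_nat_recr//=; congr (_ + _).
  apply: eq_big_nat => j /andP[_ jv].
  by rewrite nth_rcons jv -cats1 takel_cat// ltnW.
by rewrite nth_rcons ltnn eqxx -cats1 take_size_cat.
Qed.

Lemma minimax_leP n v x y : reflect
  (exists2 u, size u = n & forall k, (k <= n)%N ->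
     position x (v ++ take k u) - position x v - m * k%:R <= y)
  (minimax n v x <= y).
Proof.
elim: n v y => [|n IH] v y.
  apply: (iffP idP) => [y0|[u _ /(_ 0%N isT)]].
    exists [::] => // k; rewrite leqn0 => /eqP ->.
    by rewrite cats0 subrr mulr0 subr0.
  by rewrite take0 cats0 subrr mulr0 subr0.
rewrite minimax_leS; apply: (iffP andP) => [[y0 /existsP[i]]|[u su hu]].
  rewrite -lerBrDl => /IH[u su hu]; exists (i :: u) => [|[|k] kn]; first by rewrite /= su.
    by rewrite cats0 subrr mulr0 subr0.
  rewrite /= -cat_rcons -natr1.
  by have := hu k kn; rewrite position_rcons; lra.
split.
  by have := hu 0%N isT; rewrite take0 cats0 subrr mulr0 subr0.
case: u su hu => [//|i u] /= [su] hu; apply/existsP; exists i.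
rewrite -lerBrDl; apply/IH; exists u => // k kn.
have := hu k.+1 kn; rewrite /= -cat_rcons -natr1 position_rcons; lra.
Qed.

Lemma min_max_deviationE n x : min_max_deviation m x n = minimax n [::] x.
Proof.
rewrite /min_max_deviation; set E := \big[_/_]_(v : n.-tuple _) _.
have EleP y : (E <= y%:E)%E <-> minimax n [::] x <= y.
  have pos0 : position x [::] = 0 by rewrite /position big_ord0.
  split.
    move=> /bigmin_leP[|[u _ /bigmax_leP[_ hu]]]; first by rewrite leNgt ltry.
    apply/minimax_leP; exists (u : seq _); first exact: size_tuple.
    move=> k kn; have := hu (Ordinal (kn : (k < n.+1)%N)) isT.
    by rewrite lee_fin pos0 subr0.
  move=> /minimax_leP[u su hu]; apply/bigmin_leP; right.
  exists (Tuple (introT eqP su)) => //; apply/bigmax_leP; split; first exact: leNye.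
  move=> k _; rewrite lee_fin; have := hu k; rewrite pos0 subr0; apply.
  by rewrite -ltnS.
(* [EleP] gives E the same real upper bounds as a real number, which excludes both infinities. *)
move: E EleP => [r| |] /= EleP.
- apply/eqP; rewrite eq_le; apply/andP; split.
    by have /EleP := lexx (minimax n [::] x).
  by apply/EleP.
- by have /EleP := lexx (minimax n [::] x).
- have /EleP : (-oo <= (minimax n [::] x - 1)%:E)%E by exact: leNye.
  by rewrite lerBrDr gerDl ler10.
Qed.

(** An optimal path of length n + 1, cut at length n, does at least as well. *)
Lemma minimax_nd v x : {homo (fun n => minimax n v x) : n n' / (n <= n')%N >-> n <= n'}.
Proof.
apply: homo_leq => [//|a c e ac ce|n]; first exact: le_trans ac ce.
have /minimax_leP[u su hu] := lexx (minimax n.+1 v x).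
apply/minimax_leP; exists (take n u); first by rewrite size_take su ltnSn.
by move=> k kn; rewrite take_takel// hu// (leq_trans kn).
Qed.

End path_minimax.

Section minimax_law.
Context {R : realType} {b : nat} (i0 : 'I_b) (m : R) d (Omega : measurableType d)
  (P : probability Omega R) (X : edge b -> {RV P >-> R}) (nu : probability R R).
Hypothesis X_indep : mutually_independent X.
Hypothesis X_law : forall e (B : set R), measurable B ->
  P ((fun w => X e w - m) @^-1` B) = nu B.
Implicit Types (v : vertex b).

Let dev n v (w : Omega) : R := minimax i0 m n v (fun e => X e w).

Let below v : set (edge b) := [set e | prefix v e.1].
(** An edge is indexed by its upper end, so the edge leading to a child lies outside the child's own
    [below] and has to be added. *)
Let branch v i : set (edge b) := [set e | e = (v, i) \/ below (rcons v i) e].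

Lemma branch_disjoint v i j : i != j -> branch v i `&` branch v j = set0.
Proof.
move=> ij; have size_le k e : below (rcons v k) e -> (size v < size e.1)%N.
  by move=> /size_prefix; rewrite size_rcons.
rewrite -subset0 => e [[ei|ie] [ej|je]].
- by move: ij; rewrite -[i]/((v, i).2) -ei ej eqxx.
- by have := size_le _ _ je; rewrite ei ltnn.
- by have := size_le _ _ ie; rewrite ej ltnn.
have nthE k : below (rcons v k) e -> nth i0 e.1 (size v) = k.
  by move=> /prefixP[s' ->]; rewrite cat_rcons nth_cat ltnn subnn.
by move: ij; rewrite -(nthE _ ie) -(nthE _ je) eqxx.
Qed.

Lemma child_measurable v i n (S : set (edge b)) : S (v, i) ->
  measurable_fun (setT : set (g_sigma_algebraType (cylinders X S))) (dev n (rcons v i)) ->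
  measurable_fun (setT : set (g_sigma_algebraType (cylinders X S)))
    (fun w => X (v, i) w - m + dev n (rcons v i) w).
Proof.
move=> Svi mdev; apply: measurable_funD => //; apply: measurable_funB => //.
exact: measurable_sigma_gen.
Qed.

Lemma minimax_measurable n v :
  measurable_fun (setT : set (g_sigma_algebraType (cylinders X (below v)))) (dev n v).
Proof.
elim: n v => [|n IH] v; first exact: measurable_cst.
have mi i : measurable_fun (setT : set (g_sigma_algebraType (cylinders X (below v))))
    (fun w => X (v, i) w - m + dev n (rcons v i) w).
  apply: child_measurable; first exact: prefix_refl.
  apply: measurable_fun_sigma_gen_sub (IH (rcons v i)) => e.
  by apply: prefix_trans; exact: prefix_rcons.
rewrite (_ : dev n.+1 v = (fun w => Num.max 0
  (\big[Num.min/X (v, i0) w - m + dev n (rcons v i0) w]_(i <- index_enum 'I_b)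
    (X (v, i) w - m + dev n (rcons v i) w))))//.
apply: measurable_maxr; first exact: measurable_cst.
elim: (index_enum _) => [|i r IHr].
  by under eq_fun do rewrite big_nil; exact: mi.
by under eq_fun do rewrite big_cons; apply: measurable_minr.
Qed.

Lemma minimax_measurableT n v : measurable_fun (setT : set Omega) (dev n v).
Proof.
apply: (@measurable_fun_sigma_gen _ _ _ _ _ X (below v)).
exact: minimax_measurable.
Qed.

Lemma probability_child n v i y :
  (forall z, P [set w | dev n (rcons v i) w <= z] = (survival nu b n z)%:E) ->
  P [set w | X (v, i) w - m + dev n (rcons v i) w <= y] =
    (conv nu (survival nu b n) y)%:E.
Proof.
move=> IH.
have mU : measurable_fun setT (fun w => X (v, i) w - m) by exact: measurable_funB.
pose U : {RV P >-> R} := HB.pack (fun w => X (v, i) w - m) (isMeasurableFun.Build _ _ _ _ _ mU).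
have mV := minimax_measurableT n (rcons v i).
pose V : {RV P >-> R} := HB.pack (dev n (rcons v i)) (isMeasurableFun.Build _ _ _ _ _ mV).
have := @probability_add_indep _ _ R P U V y.
rewrite /= => ->; last first.
  move=> A B mA mB; apply: (@sigma_gen_indep _ _ _ _ _ _ X_indep [set (v, i)] (below (rcons v i))).
  - rewrite -subset0 => e [/= -> ].
    by move=> /size_prefix; rewrite size_rcons ltnn.
  - apply: sigma_gen_preimage => //; apply: measurable_funB => //.
    exact: measurable_sigma_gen.
  - by apply: sigma_gen_preimage => //; exact: minimax_measurable.
under eq_integral do rewrite IH.
rewrite /conv /Rintegral fineK.
  by apply: eq_measure_integral => A mA _; exact: X_law.
by apply: integrable_fin_num => //; apply: survival_like_integrable; exact: survival_like_survival.
Qed.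

Lemma minimax_law n v y : P [set w | dev n v w <= y] = (survival nu b n y)%:E.
Proof.
elim: n v y => [|n IH] v y.
  rewrite /dev /=; case: ifPn => y0.
    by rewrite (_ : [set _ | _] = setT) ?probability_setT//; apply/seteqP; split.
  by rewrite (_ : [set _ | _] = set0) ?measure0// -subset0 => w; exact/negP.
pose Z i w := X (v, i) w - m + dev n (rcons v i) w.
rewrite survivalS /branch_step; case: ifPn => y0; last first.
  rewrite (_ : [set _ | _] = set0) ?measure0// -subset0 => w.
  by rewrite /= /dev minimax_leS (negbTE y0).
pose A i := ~` [set w | Z i w <= y].
have mZ i : measurable_fun (setT : set (g_sigma_algebraType (cylinders X (branch v i)))) (Z i).
  apply: child_measurable; first by left.
  apply: (@measurable_fun_sigma_gen_sub _ _ _ _ _ X (below (rcons v i))).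
    by move=> e; right.
  exact: minimax_measurable.
have SA i : sigma_gen X (branch v i) (A i).
  apply: (@measurableC _ (g_sigma_algebraType (cylinders X (branch v i)))).
  rewrite -[X in measurable X]setTI.
  by apply: (@measurable_fun_le _ (g_sigma_algebraType (cylinders X (branch v i)))).
(* Survival fails exactly when every child fails, and these failures depend on disjoint sets of
   edges. *)
have -> : [set w | dev n.+1 v w <= y] = ~` (\big[setI/setT]_(i <- enum 'I_b) A i).
  apply/seteqP; split=> w /=; rewrite /dev minimax_leS y0/=.
    move=> /existsP[i hi]; rewrite (big_rem i) ?mem_enum//= => -[].
    by rewrite /A /= => /(_ hi).
  move=> nA; apply/existsP; apply: contrapT => nZ; apply: nA.
  apply: (big_ind (fun S : set Omega => S w)) => // i _; rewrite /A /= => hi.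
  by apply: nZ; exists i.
have mA i : measurable (A i) by exact: sigma_gen_measurable (SA i).
rewrite probability_setC; last first.
  by apply: (big_ind measurable) => // ? ?; exact: measurableI.
rewrite (sigma_gen_indep_big X_indep (enum_uniq _) (@branch_disjoint v) SA).
have PA i : P (A i) = (1 - conv nu (survival nu b n) y)%:E.
  rewrite probability_setC; last first.
    by rewrite -[X in measurable X]setCK; apply: measurableC; exact: mA.
  by rewrite probability_child.
under eq_bigr do rewrite PA.
by rewrite prodEFin big_const_seq count_predT size_enum_ord iter_mulr_1 -EFinB.
Qed.

End minimax_law.

(** * Moments of the increments *)

Section density.
Local Open Scope ereal_scope.
Context d (T : measurableType d) (R : realType).
Variables (mu : {sigma_finite_measure set T -> \bar R})
  (nu : {finite_measure set T -> \bar R}) (D : T -> R).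
Hypothesis mD : measurable_fun setT D.
Hypothesis D0 : forall x, (0 <= D x)%R.
Hypothesis nuE : forall A, measurable A -> nu A = \int[mu]_(x in A) (D x)%:E.

Let nu_dom : nu `<< mu.
Proof.
apply/null_content_dominatesP => A mA muA.
rewrite nuE//; apply: null_set_integral => //.
apply: measurable_funTS; exact/measurable_EFinP.
Qed.

Let D_integrable : mu.-integrable setT (EFin \o D).
Proof.
apply/integrableP; split; first exact/measurable_EFinP.
under eq_integral do rewrite /= ger0_norm//.
by rewrite -nuE// -ge0_fin_numE ?fin_num_measure.
Qed.

(** [D] coincides almost everywhere with the Radon-Nikodym derivative, for which the change of
    variables is known. *)
Lemma ge0_integral_density (f : T -> \bar R) : measurable_fun setT f ->
  (forall x, 0 <= f x) -> \int[nu]_x f x = \int[mu]_x (f x * (D x)%:E).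
Proof.
move=> mf f0.
rewrite -(Radon_Nikodym_SigmaFinite.change_of_variables nu_dom f0 measurableT mf).
have intRN := Radon_Nikodym_SigmaFinite.f_integrable nu_dom.
apply: ge0_ae_eq_integral => //.
- by apply: emeasurable_funM => //; exact: measurable_int intRN.
- by apply: emeasurable_funM => //; exact/measurable_EFinP.
- by move=> x _; rewrite mule_ge0// Radon_Nikodym_SigmaFinite.f_ge0.
- by move=> x _; rewrite mule_ge0// lee_fin.
apply: ae_eqe_mul2l; apply: integral_ae_eq => //.
- exact/measurable_EFinP.
- by move=> A _ mA; rewrite -Radon_Nikodym_SigmaFinite.f_integral// nuE.
Qed.

Lemma integral_density (f : T -> \bar R) : measurable_fun setT f ->
  \int[nu]_x f x = \int[mu]_x (f x * (D x)%:E).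
Proof.
move=> mf; rewrite integralE [RHS]integralE; congr (_ - _).
  rewrite ge0_integral_density; [|exact: measurable_funepos|by move=> x; exact: funepos_ge0].
  apply: eq_integral => x _; rewrite unlock.
  by rewrite maxe_pMl ?mul0e// lee_fin.
rewrite ge0_integral_density; [|exact: measurable_funeneg|by move=> x; exact: funeneg_ge0].
apply: eq_integral => x _; rewrite unlock.
by rewrite maxe_pMl ?mul0e ?mulNe// lee_fin.
Qed.

End density.

Section exponential_moments.
Context {R : realType}.

Lemma norm_exp_le (h y : R) k : 0 < h ->
  `|y| ^+ k <= k`!%:R / h ^+ k * (expR (h * y) + expR (- h * y)).
Proof.
move=> h0; have hk : 0 < h ^+ k by rewrite exprn_gt0.
have e1 : expR (h * `|y|) <= expR (h * y) + expR (- h * y).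
  have [y0|y0] := leP 0 y; first by rewrite ger0_norm// lerDl expR_ge0.
  by rewrite ltr0_norm// mulrN -mulNr lerDr expR_ge0.
have hy : 0 <= h * `|y| by rewrite mulr_ge0// ltW.
have e2 : (h * `|y|) ^+ k / k`!%:R <= expR (h * `|y|).
  case: k {hk} => [|k]; last by apply: le_trans (expR_ge1Dxn k hy); rewrite lerDr.
  by rewrite expr0 fact0 divr1 -(expR0 R) ler_expR.
have k0 : 0 < k`!%:R :> R by rewrite ltr0n fact_gt0.
move: (le_trans e2 e1); rewrite ler_pdivrMr// exprMn => e3.
by rewrite mulrAC ler_pdivlMr// mulrC (mulrC _%:R).
Qed.

Lemma exp_monomial_le (lm h y : R) k : 0 < h ->
  `|expR (lm * y) * y ^+ k| <=
  k`!%:R / h ^+ k * (expR ((lm + h) * y) + expR ((lm - h) * y)).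
Proof.
move=> h0; rewrite normrM normrX (ger0_norm (expR_ge0 _)) !mulrDl !expRD -mulrDr mulrCA.
by rewrite ler_wpM2l ?expR_ge0// norm_exp_le.
Qed.

Lemma exp_monomial_integrable d (T : measurableType d) (mu : {measure set T -> \bar R})
    (Y : T -> R) (lm h : R) k : 0 < h -> measurable_fun setT Y ->
  mu.-integrable setT (EFin \o (fun x => expR ((lm + h) * Y x))) ->
  mu.-integrable setT (EFin \o (fun x => expR ((lm - h) * Y x))) ->
  mu.-integrable setT (EFin \o (fun x => expR (lm * Y x) * Y x ^+ k)).
Proof.
move=> h0 mY I1 I2.
have I3 := integrableZl measurableT (k`!%:R / h ^+ k) (integrableD measurableT I1 I2).
apply: le_integrable I3 => //.
  apply/measurable_EFinP; apply: measurable_funM; last exact: measurable_funX.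
  by apply: measurableT_comp => //; exact: measurable_funM.
move=> x _; rewrite /= lee_fin; apply: (le_trans (exp_monomial_le _ _ _ h0)).
exact: ler_norm.
Qed.

Lemma tilted_moments_intro (nu : probability R R) b (lm h : R) : 0 < h ->
  nu.-integrable setT (EFin \o (fun y => expR ((lm + h) * y))) ->
  nu.-integrable setT (EFin \o (fun y => expR ((lm - h) * y))) ->
  b%:R * (\int[nu]_y (expR (lm * y) * y ^+ 0)) = 1 ->
  \int[nu]_y (expR (lm * y) * y ^+ 1) = 0 ->
  tilted_moments nu b (- lm) (b%:R * (\int[nu]_y (expR (lm * y) * y ^+ 2)))
    (b%:R * (\int[nu]_y (expR (lm * y) * y ^+ 4))).
Proof.
move=> h0 I1 I2 E0 E1 c0 c1 c2 c4.
have I k : nu.-integrable setT (EFin \o (fun y => expR (lm * y) * y ^+ k)).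
  exact: (@exp_monomial_integrable _ _ nu id lm h k h0 (@measurable_id _ _ _) I1 I2).
have Z (c : R) k : nu.-integrable setT (EFin \o (fun y => c * (expR (lm * y) * y ^+ k))).
  exact: (integrableZl measurableT c (I k)).
have D (f g : R -> R) : nu.-integrable setT (EFin \o f) -> nu.-integrable setT (EFin \o g) ->
    nu.-integrable setT (EFin \o (fun y => f y + g y)).
  by move=> If Ig; exact: (integrableD measurableT If Ig).
have -> : (fun x : R => expR (- - lm * x) * (c0 + c1 * x + c2 * x ^+ 2 + c4 * x ^+ 4)) =
    (fun y => c0 * (expR (lm * y) * y ^+ 0) + c1 * (expR (lm * y) * y ^+ 1) +
              c2 * (expR (lm * y) * y ^+ 2) + c4 * (expR (lm * y) * y ^+ 4)).
  by apply/funext => x; rewrite opprK expr0 expr1; ring.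
have D2 := D _ _ (Z c0 0%N) (Z c1 1%N); have D3 := D _ _ D2 (Z c2 2%N).
split; first exact: D _ _ D3 (Z c4 4%N).
rewrite RintegralD// RintegralD// RintegralD// !RintegralZl// E1 !mulrDr.
by rewrite (mulrCA _ c0) E0 !(mulrCA b%:R); ring.
Qed.

End exponential_moments.

Section law_of_increments.
Context {R : realType} (F : cumulativeBounded (0 : R) (1 : R)).

Lemma law_unique (mu : {measure set (measurableTypeR R) -> \bar R}) :
  (mu setT < +oo)%E -> (forall r : R, mu [set x | (x <= r)%R] = (F r)%:E) ->
  forall A : set (measurableTypeR R), measurable A -> mu A = law F A.
Proof.
move=> mufin muF A mA; apply/esym; apply: lebesgue_stieltjes_measure_unique => //.
move=> I [[x y]]/= _ <-.
rewrite /lebesgue_stieltjes_measure /measure_extension/=.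
rewrite measurable_mu_extE/=; last exact: is_ocitv.
have [xy|yx] := leP x y; last first.
  by rewrite set_itv_ge ?wlength0 ?measure0// bnd_simp -leNgt ltW.
rewrite wlength_itv_bnd//.
have mle (r : R) : measurable ([set z | z <= r] : set (measurableTypeR R)).
  have -> : [set z | z <= r] = [set` `]-oo, r]] by apply/seteqP; split=> z /=; rewrite in_itv.
  exact: measurable_itv.
have -> : `]x, y]%classic = [set z | z <= y] `\` [set z | z <= x].
  apply/seteqP; split=> z /=; rewrite in_itv/=.
    by move=> /andP[xz zy]; split => //; apply/negP; rewrite -ltNge.
  by move=> [zy /negP]; rewrite -ltNge => ->.
have sub : [set z | z <= x] `<=` [set z | z <= y] by move=> z /= /le_trans; apply.
rewrite measureD//; last by rewrite (le_lt_trans _ mufin)// le_measure ?inE.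
by rewrite (setIidr sub) EFinB; congr (_ - _)%E; exact/esym/muF.
Qed.

Lemma law_distribution d (T : measurableType d) (P : probability T R) (X : {RV P >-> R}) :
  (forall r, cdf X r = (F r)%:E) ->
  forall A : set R, measurable A -> P (X @^-1` A) = law F A.
Proof.
move=> XF A mA.
have mX : measurable_fun setT (X : T -> measurableTypeR R).
  have mX : measurable_fun setT (X : T -> R) by exact: measurable_funP.
  by move=> _ B mB; exact: mX measurableT B mB.
pose X' : {mfun T >-> measurableTypeR R} :=
  HB.pack (X : T -> measurableTypeR R) (isMeasurableFun.Build _ _ _ _ _ mX).
rewrite -[LHS]/(distribution P X' A); apply: law_unique => //.
  by rewrite (le_lt_trans (probability_le1 _ _))// ltry.
Qed.

End law_of_increments.

Section log_moment_generating_function.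
Context {R : realType} (F : cumulativeBounded (0 : R) (1 : R)).
Implicit Types (l lm h m : R).

Local Notation law := (law F).

Definition mgf_real l : R := \int[law]_x expR (l * x).

Lemma measurable_expM l :
  measurable_fun setT (fun x : measurableTypeR R => expR (l * x) : R).
Proof. by apply: measurableT_comp => //; exact: measurable_funM. Qed.

Lemma integrable_mgf l : (mgf F l < +oo)%E ->
  law.-integrable setT (EFin \o (fun x => expR (l * x))).
Proof.
move=> lfin; apply/integrableP; split.
  by apply/measurable_EFinP; exact: measurable_expM.
under eq_integral do rewrite /= ger0_norm ?expR_ge0//.
by rewrite -mgfE.
Qed.

Lemma fine_mgf l : fine (mgf F l) = mgf_real l.
Proof. by rewrite mgfE. Qed.

Lemma mgf_real_gt0 l : (mgf F l < +oo)%E -> 0 < mgf_real l.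
Proof. by move=> lfin; rewrite -fine_mgf fine_gt0// mgf_gt0. Qed.

Lemma log_mgf_lty l : (log_mgf F l < +oo)%E -> (mgf F l < +oo)%E.
Proof. by rewrite /log_mgf ltey; apply: contraTT; rewrite -leNgt leye_eq => /eqP ->. Qed.

(** Where the moment generating function is infinite, both sides are 0 by convention; equality as
    functions allows rewriting under the derivative. *)
Lemma fine_log_mgf : fine \o log_mgf F = @ln R \o mgf_real.
Proof.
apply/funext => l /=; rewrite -fine_mgf /log_mgf.
have := mgf_gt0 F l; case: (mgf F l) => [r| |] // r0.
  by rewrite lne_EFin.
by rewrite /= ln0.
Qed.

Lemma interior_mgf lm : [set l : R | (log_mgf F l < +oo)%E]° lm ->
  exists h, [/\ 0 < h, (mgf F (lm + h) < +oo)%E & (mgf F (lm - h) < +oo)%E].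
Proof.
move=> /nbhs_ballP[e /= e0 he]; exists (e / 2); split; first by rewrite divr_gt0.
  apply: log_mgf_lty; apply: he; rewrite /ball/= opprD addrA subrr sub0r normrN.
  by rewrite gtr0_norm ?divr_gt0//; lra.
apply: log_mgf_lty; apply: he; rewrite /ball/= opprB addrC subrK.
by rewrite gtr0_norm ?divr_gt0//; lra.
Qed.

Lemma is_derive_mgf_real lm h : 0 < h ->
  (mgf F (lm + h) < +oo)%E -> (mgf F (lm - h) < +oo)%E ->
  is_derive lm 1 mgf_real (\int[law]_x (expR (lm * x) * x ^+ 1)).
Proof.
move=> h0 fin1 fin2.
have I1 := integrable_mgf fin1; have I2 := integrable_mgf fin2.
have h20 : 0 < h / 2 by rewrite divr_gt0.
pose f (l : R) (x : measurableTypeR R) : R := expR (l * x).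
(* Half of the radius is kept back to dominate the factor x that differentiation produces. *)
pose I : set R := [set` `](lm - h / 2), (lm + h / 2)[].
have Ilm : I lm by rewrite /I /= in_itv/=; apply/andP; split; lra.
have IE l : I l -> `|l - lm| <= h / 2.
  by rewrite /I /= in_itv/= ler_norml => /andP[? ?]; apply/andP; split; lra.
have df l x : is_derive l 1 (f ^~ x) (expR (l * x) * x).
  have dlin : is_derive l 1 (fun t : R => t * x) x.
    have := @is_deriveM R R id (cst x) l 1 1 0 (is_derive_id _ _) (is_derive_cst _ _ _).
    by rewrite scaler0 add0r /GRing.scale/= mulr1.
  by have := @is_derive1_comp R expR (fun t => t * x) l _ _ (is_derive_expR _) dlin.
have le_f l x : `|l - lm| <= h -> f l x <= expR ((lm + h) * x) + expR ((lm - h) * x).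
  rewrite ler_norml => /andP[l1 l2].
  have [x0|x0] := leP 0 x.
    apply: (@le_trans _ _ (expR ((lm + h) * x))); last by rewrite lerDl expR_ge0.
    by rewrite ler_expR ler_wpM2r//; lra.
  apply: (@le_trans _ _ (expR ((lm - h) * x))); last by rewrite lerDr expR_ge0.
  by rewrite ler_expR ler_wnM2r// ?(ltW x0)//; lra.
have intf l : I l -> law.-integrable setT (EFin \o f l).
  move=> Il; apply: le_integrable (integrableD measurableT I1 I2) => //.
    by apply/measurable_EFinP; exact: measurable_expM.
  move=> x _; rewrite /= lee_fin ger0_norm ?expR_ge0//.
  apply: le_trans (ler_norm _); apply: le_f.
  by apply: (le_trans (IE _ Il)); lra.
pose G (x : measurableTypeR R) : R := 2 * (2 / h) * (expR ((lm + h) * x) + expR ((lm - h) * x)).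
have h2 : 0 <= 2 / h by rewrite divr_ge0// ltW.
have G0 x : 0 <= G x by rewrite mulr_ge0 ?addr_ge0 ?expR_ge0// mulr_ge0.
have IG : law.-integrable setT (EFin \o G).
  exact: (integrableZl measurableT (2 * (2 / h)) (integrableD measurableT I1 I2)).
have d1E l x : partial1of2 f l x = expR (l * x) * x.
  by rewrite partial1of2E; have := df l x; case.
have Gub l x : I l -> setT x -> `|partial1of2 f l x| <= G x.
  move=> /IE; rewrite ler_norml => /andP[l1 l2] _; rewrite d1E.
  have := @exp_monomial_le R l (h / 2) x 1 h20; rewrite expr1 => /le_trans; apply.
  have -> : (1`!%:R : R) / (h / 2) ^+ 1 = 2 / h by rewrite expr1 div1r invf_div.
  have -> : G x = 2 / h * ((expR ((lm + h) * x) + expR ((lm - h) * x)) +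
    (expR ((lm + h) * x) + expR ((lm - h) * x))) by rewrite /G; ring.
  rewrite ler_wpM2l//.
  by apply: lerD; apply: le_f; rewrite ler_norml; apply/andP; split; lra.
have derf l x : I l -> setT x -> derivable (f ^~ x) l 1.
  by move=> _ _; case: (df l x).
have hd := @derivable_under_integral R _ _ law f setT measurableT lm
  (lm - h / 2) (lm + h / 2) Ilm intf derf G G0 IG Gub.
apply: DeriveDef => //.
rewrite -derive1E.
rewrite (@differentiation_under_integral R _ _ law f setT measurableT lm
  (lm - h / 2) (lm + h / 2) Ilm intf derf G G0 IG Gub).
by apply: eq_Rintegral => x _; rewrite d1E.
Qed.

End log_moment_generating_function.

Section centered_law.
Context {R : realType} (F : cumulativeBounded (0 : R) (1 : R)) (m : R).

Local Notation law := (law F).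

Definition centering (x : measurableTypeR R) : R := x - m.

Let measurable_centering : measurable_fun setT centering.
Proof. by apply: measurable_funB => //; exact: measurable_cst. Qed.

HB.instance Definition _ :=
  isMeasurableFun.Build _ _ _ _ centering measurable_centering.

Definition centered_law : probability R R := distribution law centering.

Lemma integrable_centered (f : R -> R) : measurable_fun setT f ->
  law.-integrable setT (EFin \o (fun x => f (x - m))) ->
  centered_law.-integrable setT (EFin \o f).
Proof.
move=> mf If; apply: integrable_pushforward => //.
exact/measurable_EFinP.
Qed.

Lemma Rintegral_centered (f : R -> R) : measurable_fun setT f ->
  law.-integrable setT (EFin \o (fun x => f (x - m))) ->
  \int[centered_law]_y f y = \int[law]_x f (x - m).
Proof.
move=> mf If; rewrite /Rintegral integral_distribution//.
exact/measurable_EFinP.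
Qed.

Lemma centered_law_tail (l : R) : 0 < l -> (mgf F l < +oo)%E -> forall t : R,
  (centered_law [set x | (t < x)%R] <=
     (mgf_real F l * expR (- (l * m)) * expR (- (l * t)))%:E)%E.
Proof.
move=> l0 lfin t.
have mid : measurable_fun setT (idfun : measurableTypeR R -> R) by exact: measurable_id.
pose idX : {mfun measurableTypeR R >-> R} :=
  HB.pack (idfun : measurableTypeR R -> R) (isMeasurableFun.Build _ _ _ _ _ mid).
have := @chernoff _ _ R law idX l (t + m) l0.
rewrite -[X in (_ <= X * _)%E]/(mgf F l).
have -> : mgf F l = (mgf_real F l)%:E.
  by rewrite -fine_mgf fineK// ge0_fin_numE// ltW// mgf_gt0.
rewrite -EFinM mulrDr opprD (addrC (- (l * t))) expRD mulrA; apply: le_trans.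
rewrite -[leLHS]/(law (centering @^-1` [set x | (t < x)%R])).
apply: (@le_measure _ _ _ law); rewrite ?inE.
- rewrite -[X in measurable X]setTI; apply: measurable_centering => //.
  have -> : [set x | (t < x)%R] = [set` `]t, +oo[].
    by apply/seteqP; split=> x /=; rewrite in_itv/= andbT.
  exact: measurable_itv.
- by rewrite -[X in measurable X]setTI; apply: (@measurable_fun_le _ (measurableTypeR R)).
by move=> x /=; rewrite /centering ltrBrDr => /ltW.
Qed.

End centered_law.

(** * Moments of the centered law under the tilt *)

Section tilted_moments_of_centered_law.
Context {R : realType} (F : cumulativeBounded (0 : R) (1 : R)) (b : nat) (lm h : R).
Hypothesis h0 : 0 < h.
Hypothesis fin0 : (log_mgf F lm < +oo)%E.
Hypothesis fin1 : (mgf F (lm + h) < +oo)%E.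
Hypothesis fin2 : (mgf F (lm - h) < +oo)%E.

Local Notation law := (law F).

Let m : R := ((fine \o log_mgf F)^`())%classic lm.

Hypothesis lm_eq : lm * m - fine (log_mgf F lm) = ln b%:R.
Hypothesis b2 : (2 <= b)%N.

Let nu := centered_law F m.

Let M0 : 0 < mgf_real F lm.
Proof. by apply: mgf_real_gt0; exact: log_mgf_lty. Qed.

Lemma moment_integrable k c :
  law.-integrable setT (EFin \o (fun x => expR (lm * (x - c)) * (x - c) ^+ k)).
Proof.
apply: (@exp_monomial_integrable _ _ _ law (fun x => x - c) lm h) => //.
- by apply: measurable_funB => //; exact: measurable_cst.
- have := integrableZl measurableT (expR (- ((lm + h) * c))) (integrable_mgf fin1).
  apply: eq_integrable => // x _ /=; rewrite -EFinM -expRD; congr (expR _)%:E; ring.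
have := integrableZl measurableT (expR (- ((lm - h) * c))) (integrable_mgf fin2).
apply: eq_integrable => // x _ /=; rewrite -EFinM -expRD; congr (expR _)%:E; ring.
Qed.

Lemma log_mgf_derivative : m * mgf_real F lm = \int[law]_x (expR (lm * x) * x ^+ 1).
Proof.
have d1 := is_derive_mgf_real h0 fin1 fin2.
have d2 := @is_derive1_comp R (@ln R) (mgf_real F) lm _ _ (is_derive1_ln M0) d1.
rewrite /m fine_log_mgf derive1E derive_val mulrC mulrA mulfV ?mul1r//.
by rewrite gt_eqF.
Qed.

(** Here the equation defining lm enters: it identifies the density of Q with the weight b exp(lm (x
    - m)) of the branching recursion. *)
Lemma branching_normalization x :
  expR (lm * x - fine (log_mgf F lm)) = b%:R * expR (lm * (x - m)).
Proof.
have b0 : (0 : R) < b%:R by rewrite ltr0n (leq_trans _ b2).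
have -> : (b%:R : R) = expR (ln b%:R) by rewrite lnK.
by rewrite -lm_eq -expRD; congr expR; ring.
Qed.

Lemma moment_centered k :
  \int[nu]_y (expR (lm * y) * y ^+ k) = \int[law]_x (expR (lm * (x - m)) * (x - m) ^+ k).
Proof.
rewrite Rintegral_centered//; last exact: moment_integrable.
apply: measurable_funM; last exact: measurable_funX.
by apply: measurableT_comp => //; exact: measurable_funM.
Qed.

Lemma moment0 : b%:R * (\int[nu]_y (expR (lm * y) * y ^+ 0)) = 1.
Proof.
rewrite moment_centered -RintegralZl//; last exact: moment_integrable.
have -> : (fun x => b%:R * (expR (lm * (x - m)) * (x - m) ^+ 0)) =
    (fun x => expR (- fine (log_mgf F lm)) * expR (lm * x)).
  apply/funext => x; rewrite expr0 mulr1 -branching_normalization -expRD.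
  by congr expR; ring.
rewrite RintegralZl//; last exact: (integrable_mgf (log_mgf_lty fin0)).
rewrite -[X in _ * X]/(mgf_real F lm) -[fine _]/((fine \o log_mgf F) lm).
by rewrite fine_log_mgf /= expRN lnK ?mulVf// gt_eqF.
Qed.

Lemma moment1 : \int[nu]_y (expR (lm * y) * y ^+ 1) = 0.
Proof.
rewrite moment_centered.
have I1 := moment_integrable 1 0; rewrite [X in _.-integrable _ (_ \o X)](_ : _ =
  (fun x => expR (lm * x) * x ^+ 1)) in I1; last first.
  by apply/funext => x; rewrite subr0.
have I0 := integrable_mgf (log_mgf_lty fin0).
have -> : (fun x => expR (lm * (x - m)) * (x - m) ^+ 1) =
    (fun x => expR (- (lm * m)) * (expR (lm * x) * x ^+ 1 - m * expR (lm * x))).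
  by apply/funext => x; rewrite (mulrBr lm) expRD; ring.
have I0m := integrableZl measurableT m I0.
rewrite RintegralZl//; last exact: (integrableB measurableT I1 I0m).
by rewrite RintegralB// RintegralZl// -log_mgf_derivative subrr mulr0.
Qed.

Let Q := tilted_law F lm.

Let Q_density (A : set (measurableTypeR R)) : measurable A ->
  Q A = (\int[law]_(x in A) (expR (lm * x - fine (log_mgf F lm)))%:E)%E.
Proof. by move=> mA; rewrite /Q /tilted_law fin0. Qed.

Let measurable_tilt :
  measurable_fun setT (fun x : measurableTypeR R => expR (lm * x - fine (log_mgf F lm)) : R).
Proof.
by apply: measurableT_comp => //; apply: measurable_funB.
Qed.

Let Q_integral (f : measurableTypeR R -> \bar R) : measurable_fun setT f ->
  (\int[Q]_x f x = \int[law]_x (f x * (expR (lm * x - fine (log_mgf F lm)))%:E))%E.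
Proof.
by move=> mf; apply: (@integral_density _ _ _ law Q _ measurable_tilt).
Qed.

Lemma tilted_mean : fine 'E_Q[idfun : R -> R] = m.
Proof.
rewrite unlock Q_integral; last by apply/measurable_EFinP; exact: measurable_id.
have -> : (fun x : measurableTypeR R => (x%:E * (expR (lm * x - fine (log_mgf F lm)))%:E)%E) =
   EFin \o (fun x => expR (- fine (log_mgf F lm)) * (expR (lm * x) * x ^+ 1)).
  by apply/funext => x; rewrite /= -EFinM expRD; congr EFin; ring.
rewrite -/(Rintegral _ _ _) RintegralZl//; last first.
  have := moment_integrable 1 0; apply: eq_integrable => // x _ /=.
  by rewrite subr0.
rewrite -log_mgf_derivative -[fine _]/((fine \o log_mgf F) lm) fine_log_mgf /=.
by rewrite expRN lnK// mulrCA mulVf ?mulr1// gt_eqF.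
Qed.

Lemma tilted_variance : fine 'V_Q[idfun : R -> R] =
  b%:R * (\int[nu]_y (expR (lm * y) * y ^+ 2)).
Proof.
rewrite /variance unlock tilted_mean unlock.
rewrite Q_integral; last first.
  by apply/measurable_EFinP; apply: measurable_funM; apply: measurable_funB;
    first [exact: measurable_id|exact: measurable_cst].
rewrite moment_centered -RintegralZl//; last exact: moment_integrable.
congr fine; apply: eq_integral => x _; rewrite /= -EFinM branching_normalization.
by congr EFin; rewrite -[X in X * _ = _]/((x - m) * (x - m)); ring.
Qed.

Lemma even_moment_ge0 k : 0 <= b%:R * (\int[nu]_y (expR (lm * y) * y ^+ k.*2)).
Proof.
rewrite mulr_ge0//; apply: Rintegral_ge0 => y _.
by rewrite mulr_ge0 ?expR_ge0// exprn_even_ge0// odd_double.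
Qed.

(* A vanishing tilted variance would make the centered law a point mass at 0,
   and the normalization of the tilt would then read b = 1. *)
Lemma second_moment_gt0 : 0 < b%:R * (\int[nu]_y (expR (lm * y) * y ^+ 2)).
Proof.
rewrite lt_neqAle (even_moment_ge0 1) andbT; apply/eqP => /esym/eqP.
rewrite mulf_eq0 pnatr_eq0 -leqn0 leqNgt (leq_trans _ b2)//= => /eqP I0.
have mf k : measurable_fun setT (fun y : R => (expR (lm * y) * y ^+ k)%:E).
  apply/measurable_EFinP; apply: measurable_funM; last exact: measurable_funX.
  by apply: measurableT_comp => //; exact: measurable_funM.
have If k : nu.-integrable setT (fun y : R => (expR (lm * y) * y ^+ k)%:E).
  by apply: integrable_centered; [apply/measurable_EFinP; exact: mf|exact: moment_integrable].
have I0' : (\int[nu]_y `|(expR (lm * y) * y ^+ 2)%:E| = 0)%E.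
  rewrite (eq_integral (fun y : R => (expR (lm * y) * y ^+ 2)%:E)); last first.
    by move=> y _; rewrite gee0_abs// lee_fin mulr_ge0 ?expR_ge0 ?sqr_ge0.
  by rewrite -[LHS]fineK ?integrable_fin_num// -/(Rintegral _ _ _) I0.
have [/(_ I0') ae0 _] := ae_eq_integral_abs nu measurableT (mf 2%N).
have : \int[nu]_y (expR (lm * y) * y ^+ 0) = 1.
  rewrite -[RHS](Rintegral_cst_prob nu); rewrite /Rintegral; congr fine.
  apply: ae_eq_integral => //.
  apply: filterS ae0 => y /= /(_ I) [] /eqP.
  rewrite mulf_eq0 expR_eq0/= sqrf_eq0 => /eqP -> _.
  by rewrite mulr0 expR0 expr0 mulr1.
move=> E1; have := moment0; rewrite E1 mulr1 => /eqP.
by rewrite pnatr_eq1 => /eqP b1; move: b2; rewrite b1.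
Qed.

End tilted_moments_of_centered_law.

(** * Almost sure convergence *)

Section almost_sure_convergence.
Context {R : realType}.

Lemma borel_cantelli_exp d (T : measurableType d) (P : probability T R)
    (A : nat -> set T) (C r : R) (N0 : nat) : 0 < C -> 0 < r ->
  (forall N, measurable (A N)) ->
  (forall N, (N0 <= N)%N -> (P (A N) <= (C * expR (- (r * N%:R)))%:E)%E) ->
  {ae P, forall w, \forall N \near \oo, ~ A N w}.
Proof.
move=> C0 r0 mA PA; pose q := expR (- r).
have q0 : 0 < q by exact: expR_gt0.
have q1 : q < 1 by rewrite expR_lt1 oppr_lt0.
have q10 : 0 < 1 - q by rewrite subr_gt0.
pose B N := A (N + N0)%N.
have PB N : (P (B N) <= (C * q ^+ N)%:E)%E.
  apply: (le_trans (PA _ (leq_addl _ _))); rewrite lee_fin ler_wpM2l ?(ltW C0)//.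
  rewrite -expRM_natl ler_expR mulrN lerN2 mulrC ler_wpM2l ?(ltW r0)//.
  by rewrite ler_nat leq_addr.
have Psum : (\sum_(N <oo) P (B N) < +oo)%E.
  apply: (@le_lt_trans _ _ (C / (1 - q))%:E); last exact: ltry.
  apply: lime_le; first by apply: is_cvg_nneseries => n _ _.
  apply: nearW => n; apply: (@le_trans _ _ (\sum_(0 <= i < n) (C * q ^+ i)%:E)%E).
    exact: lee_sum.
  rewrite sumEFin lee_fin -mulr_sumr ler_wpM2l ?(ltW C0)//.
  rewrite -[leRHS]mul1r ler_pdivlMr//.
  have -> : (\sum_(0 <= i < n) q ^+ i) * (1 - q) = 1 - q ^+ n.
    elim: n => [|n IH]; first by rewrite big_nil mul0r expr0 subrr.
    by rewrite big_nat_recr//= mulrDl IH exprSr; ring.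
  by rewrite gerBl exprn_ge0// ltW.
have P0 := lim_sup_set_cvg0 (fun N => mA (N + N0)%N) Psum.
exists (lim_sup_set B); split => //.
  by apply: bigcap_measurable => // k _; apply: bigcup_measurable => j _; exact: mA.
move=> w /= nw n _; apply: contrapT => nB; apply: nw.
exists (n + N0)%N => // N /= nN AN; apply: nB.
exists (N - N0)%N => /=; first by rewrite leq_subRL 1?addnC// (leq_trans _ nN)// leq_addl.
by rewrite /B subnK// (leq_trans _ nN)// leq_addl.
Qed.

Lemma sixth_root (n : nat) : exists N, (N ^ 6 <= n < N.+1 ^ 6)%N.
Proof.
have P0 : exists N, (N ^ 6 <= n)%N by exists 0%N.
have Pub N : (N ^ 6 <= n)%N -> (N <= n)%N.
  by apply: leq_trans; case: N => // N; rewrite -{1}(expn1 N.+1) leq_pexp2l.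
case: (ex_maxnP P0 Pub) => N Nn Nmax; exists N; rewrite Nn ltnNge /=.
by apply/negP => /Nmax; rewrite ltnn.
Qed.

Lemma powR_sixth (N : nat) : (N ^ 6)%:R `^ 3^-1 = N%:R ^+ 2 :> R.
Proof.
have -> : (N ^ 6)%:R = (N%:R ^+ 2) `^ 3 :> R.
  by rewrite powR_mulrn ?sqr_ge0// natrX -exprM.
by rewrite -powRrM mulfV// powRr1 ?sqr_ge0.
Qed.

(** The tolerances l / (j + 2) are countable, so that almost sure statements can be intersected over
    j, and smaller than l, so that the lower slope stays positive. *)
Lemma cvg_cube_root (a : nat -> R) (l : R) : 0 < l ->
  {homo a : m n / (m <= n)%N >-> m <= n} ->
  (forall j : nat, \forall N \near \oo, (l - l / j.+2%:R) * N%:R ^+ 2 <= a (N ^ 6)%N) ->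
  (forall j : nat, \forall N \near \oo, a (N ^ 6)%N <= (l + l / j.+2%:R) * N%:R ^+ 2) ->
  a n / n%:R `^ 3^-1 @[n --> \oo] --> l.
Proof.
move=> l0 nda lo up; apply/cvgrPdist_le => e e0.
pose j := Num.truncn (2 * l / e).
have ej : l / j.+2%:R <= e / 2.
  have h : 2 * l / e <= j.+2%:R.
    by apply: (le_trans (ltW (truncnS_gt _))); rewrite ler_nat.
  rewrite ler_pdivrMr ?ltr0n//; move: h; rewrite ler_pdivrMr//; lra.
pose d := l / j.+2%:R; rewrite -/d in ej.
have d0 : 0 < d by rewrite divr_gt0// ltr0n.
have dl : d <= l.
  by rewrite ler_pdivrMr ?ltr0n// ler_peMr ?(ltW l0)// ler1n.
have [N1 _ HN1] := lo j; have [N2 _ HN2] := up j; rewrite /= -/d in HN1 HN2.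
(* Passing from N^2 to (N + 1)^2 costs at most (l + d) 3 N <= 6 l N, which is then at most e N^2 /
   2. *)
pose N3 := (Num.truncn (12 * l / e)).+1.
pose N0 := (N1 + N2 + N3 + 1)%N.
exists (N0 ^ 6)%N => // n /= n0; have [N /andP[Nn nN]] := sixth_root n.
have N0N : (N0 <= N)%N by rewrite -ltnS -(@ltn_exp2r _ _ 6) // (leq_ltn_trans n0).
have N1N : (N1 <= N)%N by rewrite (leq_trans _ N0N)// /N0 -!addnA leq_addr.
have N2N : (N2 <= N.+1)%N.
  by rewrite (leq_trans _ (leqW N0N))// /N0 -!addnA addnCA leq_addr.
have N3N : (N3 <= N)%N by rewrite (leq_trans _ N0N)// /N0 -addnA addnC -addnA leq_addr.
have Npos : (0 < N)%N by rewrite (leq_trans _ N3N).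
have NR : 1 <= N%:R :> R by rewrite ler1n.
have N0R : 0 < N%:R :> R := lt_le_trans ltr01 NR.
have Nl : 12 * l <= e * N%:R.
  have : 12 * l / e <= N%:R.
    by apply: (le_trans (ltW (truncnS_gt _))); rewrite ler_nat.
  by rewrite ler_pdivrMr// (mulrC e).
set t := n%:R `^ 3^-1 : R.
have t1 : N%:R ^+ 2 <= t.
  by rewrite -powR_sixth ge0_ler_powR ?nnegrE ?ler0n ?ler_nat// invr_ge0.
have t2 : t <= N.+1%:R ^+ 2.
  by rewrite -powR_sixth ge0_ler_powR ?nnegrE ?ler0n ?ler_nat// ?invr_ge0// ltnW.
have t0 : 0 < t by rewrite (lt_le_trans _ t1)// exprn_gt0.
have a1 : (l - d) * N%:R ^+ 2 <= a n by rewrite (le_trans (HN1 N N1N))// nda.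
have a2 : a n <= (l + d) * N.+1%:R ^+ 2.
  by rewrite (le_trans _ (HN2 N.+1 N2N))// nda// ltnW.
have SN : N.+1%:R ^+ 2 <= N%:R ^+ 2 + 3 * N%:R :> R by rewrite -(natr1 N); nra.
have Nt : N%:R * N%:R <= t by rewrite -expr2.
rewrite distrC ler_norml lerBlDr lerBrDr ler_pdivrMr// ler_pdivlMr//.
have ld : 0 <= l - d by rewrite subr_ge0.
have lN : 6 * l * N%:R <= e / 2 * (N%:R * N%:R).
  by move: (ler_wpM2r (ltW N0R) Nl); lra.
have etN : e / 2 * (N%:R * N%:R) <= e / 2 * t by rewrite ler_wpM2l// divr_ge0// ltW.
have dt : d * t <= e / 2 * t by rewrite ler_wpM2r// ltW.
have dN : d * N%:R <= l * N%:R by rewrite ler_wpM2r// ltW.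
have ldt : (l - d) * t <= (l - d) * (N%:R ^+ 2 + 3 * N%:R).
  by rewrite ler_wpM2l// (le_trans t2).
have lds : (l + d) * N.+1%:R ^+ 2 <= (l + d) * (N%:R ^+ 2 + 3 * N%:R).
  by rewrite ler_wpM2l// addr_ge0// ltW.
have ltt : (l + d) * N%:R ^+ 2 <= (l + d) * t by rewrite ler_wpM2l// addr_ge0// ltW.
have dN0 : 0 <= d * N%:R by rewrite mulr_ge0 ?ltW.
by apply/andP; split; lra.
Qed.

End almost_sure_convergence.

Theorem theorem1 (R : realType) (b : nat) (hb : (2 <= b)%N)
    (F : cumulativeBounded (0 : R) (1 : R))
    (d : measure_display) (Omega : measurableType d) (P : probability Omega R)
    (X : edge b -> {RV P >-> R})
    (X_indep : mutually_independent X)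
    (X_cdf : forall (e : edge b) (r : R), cdf (X e) r = (F r)%:E)
    (mgf_neg : exists2 l : R, l < 0 & (mgf F l < +oo)%E)
    (mgf_pos : exists2 l : R, 0 < l & (mgf F l < +oo)%E)
    (lm lp : R) (lm_lt0 : lm < 0) (lp_gt0 : 0 < lp)
    (lm_int : [set l : R | (log_mgf F l < +oo)%E]° lm)
    (lp_int : [set l : R | (log_mgf F l < +oo)%E]° lp)
    (lm_eq : lm * ((fine \o log_mgf F)^`())%classic lm - fine (log_mgf F lm) = ln b%:R)
    (lp_eq : lp * ((fine \o log_mgf F)^`())%classic lp - fine (log_mgf F lp) = ln b%:R) :
  let m : R := ((fine \o log_mgf F)^`())%classic lm in
  let L (n : nat) (w : Omega) : R := min_max_deviation m (fun e => X e w) n in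
  let sigma2 : R := fine ('V_(tilted_law F lm)[idfun : R -> R])%E in
  {ae P, forall w : Omega,
    L n w / n%:R `^ (3^-1) @[n --> \oo] -->
      (3 * pi ^+ 2 * sigma2 / (- 2 * lm)) `^ (3^-1)}.
Proof.
move=> m L sigma2.
have b0 : (0 < b)%N by rewrite (leq_trans _ hb).
pose i0 : 'I_b := Ordinal b0.
have fin0 : (log_mgf F lm < +oo)%E by exact: (interior_subset lm_int).
have [h [h0 fin1 fin2]] := interior_mgf lm_int.
pose nu := centered_law F m; pose theta := - lm.
have theta0 : 0 < theta by rewrite oppr_gt0.
have sE : sigma2 = b%:R * (\int[nu]_y (expR (lm * y) * y ^+ 2)).
  exact: tilted_variance h0 fin0 fin1 fin2 lm_eq hb.
have s0 : 0 < sigma2 by rewrite sE; exact: second_moment_gt0 h0 fin0 fin1 fin2 lm_eq hb.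
pose K4 := b%:R * (\int[nu]_y (expR (lm * y) * y ^+ 4)).
have K40 : 0 <= K4 by exact: (even_moment_ge0 _ _ _ 2).
have nu_int (l : R) : (mgf F l < +oo)%E ->
    nu.-integrable setT (EFin \o (fun y => expR (l * y))).
  move=> lfin; apply: integrable_centered.
    by apply: measurableT_comp => //; exact: measurable_funM.
  have := integrableZl measurableT (expR (- (l * m))) (integrable_mgf lfin).
  by apply: eq_integrable => // x _ /=; rewrite -EFinM -expRD; congr (expR _)%:E; ring.
have tm : tilted_moments nu b theta sigma2 K4.
  rewrite sE; apply: (tilted_moments_intro h0) => //; [exact: nu_int..| |].
    exact: moment0 h0 fin0 fin1 fin2 lm_eq hb.
  exact: moment1 h0 fin0 fin1 fin2.
have X_law e (B : set R) : measurable B -> P ((fun w => X e w - m) @^-1` B) = nu B.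
  move=> mB; rewrite -[RHS]/(law F (centering m @^-1` B)).
  rewrite -(law_distribution (X_cdf e))//.
  have mc : measurable_fun setT (centering m) by exact: measurable_funP.
  by have := mc measurableT B mB; rewrite setTI.
have LE n w : L n w = minimax i0 m n [::] (fun e => X e w) by exact: min_max_deviationE.
have PL n y : P [set w | L n w <= y] = (survival nu b n y)%:E.
  by under eq_set do rewrite LE; exact: (minimax_law i0 X_indep X_law).
have mL n y : measurable [set w | L n w <= y].
  rewrite -[X in measurable X]setTI; apply: measurable_fun_le => //.
  by rewrite (funext (LE n)); exact: (minimax_measurableT i0 m X).
set l0 := (_ / _) `^ _.
have crit : 3 * pi ^+ 2 * sigma2 / (- 2 * lm) = critical_cube theta sigma2.
  by rewrite /critical_cube /theta mulrN mulNr.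
have crit0 : 0 < critical_cube theta sigma2.
  by rewrite divr_gt0 ?mulr_gt0 ?exprn_gt0 ?pi_gt0.
have l0E : l0 ^+ 3 = critical_cube theta sigma2.
  by rewrite /l0 crit -powR_mulrn ?powR_ge0// -powRrM mulVf// powRr1// ltW.
have l00 : 0 < l0 by rewrite /l0 crit powR_gt0.
have step j : 0 < l0 / j.+2%:R /\ l0 / j.+2%:R < l0.
  by split; rewrite ?divr_gt0 ?ltr0n// ltr_pdivrMr ?ltr0n// ltr_pMr// ltr1n.
have lower j : {ae P, forall w, \forall N \near \oo,
    (l0 - l0 / j.+2%:R) * N%:R ^+ 2 <= L (N ^ 6)%N w}.
  have [d0 dl] := step j; set l := l0 - _.
  have l_0 : 0 < l by rewrite subr_gt0.
  have lcrit : l ^+ 3 < critical_cube theta sigma2.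
    by rewrite -l0E ltrXn2r ?nnegrE ?(ltW l_0) ?(ltW l00)// gtrBl.
  have [C [r [C0 r0 Hup]]] := survival_subcritical theta0 s0 K40 tm l_0 lcrit.
  have := @borel_cantelli_exp R _ _ P (fun N => [set w | L (N ^ 6)%N w <= l * N%:R ^+ 2])
    C r 0 C0 r0 (fun N => mL _ _).
  move=> /(_ _)[N _|N [mN N0 sN]].
    rewrite PL lee_fin; apply: (le_trans (Hup N)).
    (* The rate in N^2 is weakened to one in N, the form shared with the upper bound. *)
    rewrite ler_wpM2l ?(ltW C0)// ler_expR lerN2 ler_wpM2l ?(ltW r0)//.
    by rewrite -natrX ler_nat; case: N => // N; rewrite -{1}(expn1 N.+1) leq_pexp2l.
  exists N; split => // w nw; apply: sN => /= hw; apply: nw.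
  by apply: filterS hw => k /negP; rewrite -ltNge => /ltW.
have upper j : {ae P, forall w, \forall N \near \oo,
    L (N ^ 6)%N w <= (l0 + l0 / j.+2%:R) * N%:R ^+ 2}.
  have [d0 dl] := step j; set l := l0 + _.
  have l_0 : 0 < l by rewrite addr_gt0.
  have lcrit : critical_cube theta sigma2 < l ^+ 3.
    by rewrite -l0E ltrXn2r ?nnegrE ?(ltW l_0) ?(ltW l00)// ltrDl.
  (* A positive exponential moment controls the large upward jumps met while boosting. *)
  have [lt lt0 ltfin] := mgf_pos.
  have Ct0 : 0 < mgf_real F lt * expR (- (lt * m)).
    by rewrite mulr_gt0 ?expR_gt0 ?mgf_real_gt0.
  have [C [r [N0 [C0 r0 Hlow]]]] := survival_supercritical hb theta0 s0 K40 tm lt0 Ct0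
    (centered_law_tail m lt0 ltfin) l_0 lcrit.
  have := @borel_cantelli_exp R _ _ P
    (fun N => ~` [set w | L (N ^ 6)%N w <= l * N%:R ^+ 2])
    C r N0 C0 r0 (fun N => measurableC (mL _ _)).
  move=> /(_ _)[N NN|N [mN PN sN]].
    rewrite probability_setC// PL -EFinB lee_fin; exact: Hlow.
  exists N; split => // w nw; apply: sN => /= hw; apply: nw.
  by apply: filterS hw => k /contrapT.
have := ae_foralln lower; have := ae_foralln upper.
apply: filterS2 => w up lo; apply: cvg_cube_root => //.
by move=> n n' nn'; rewrite !LE; exact: minimax_nd.
Qed.
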